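(* Let $X$ be a completely regular space, $p\in[1,+\infty)$, and let $\varrho$ be a metric on $\mathfrak C[X]$ inducing the topology of $\mathfrak C[X]$ and such that $\varrho^p$ is radially $1$-homogeneous. For $\mu_1,\mu_2\in\mathcal M_+(X)$ set $$\mathcal D_{\varrho,p}(\mu_1,\mu_2):=\Big(\inf\Big\{\int_{\mathfrak C[X]\times\mathfrak C[X]}\varrho^p\,d\alpha:\alpha\in\mathfrak H^1(\mu_1,\mu_2)\Big\}\Big)^{1/p},$$ and let $$\mathcal M_{\varrho,p}(X):=\Big\{\mu\in\mathcal M_+(X):\int_X\varrho^p([x,1],\mathfrak o)\,d\mu(x)<+\infty\Big\}.$$ If $(\mu_n)_n\subset\mathcal M_{\varrho,p}(X)$ and $\mu\in\mathcal M_{\varrho,p}(X)$, then $\lim_{n\to\infty}\mathcal D_{\varrho,p}(\mu_n,\mu)=0$ if and only if both $$\mu_n\rightharpoonup\mu\quad\text{and}\quad\int_X\varrho^p([x,1],\mathfrak o)\,d\mu_n(x)\to\int_X\varrho^p([x,1],\mathfrak o)\,d\mu(x).$$ In particular, if $X$ is separable, then $(\mathcal M_{\varrho,p}(X),\mathcal D_{\varrho,p})$ is also separable.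
   Context: Completely regular spaces are assumed Hausdorff; $\mathcal M_+(X)$ is the set of finite nonnegative Radon measures on $X$, and $\mu_n\rightharpoonup\mu$ means $\int\varphi\,d\mu_n\to\int\varphi\,d\mu$ for every bounded continuous $\varphi:X\to\mathbb R$. Cone: $\mathfrak C[X]=(X\times[0,+\infty))/\sim$, where $(x,r)\sim(y,s)$ iff ($x=y$ and $r=s\neq0$) or $r=s=0$; $[x,r]$ is the class of $(x,r)$ and $\mathfrak o=[x,0]$ the vertex. The topology of $\mathfrak C[X]$: a neighbourhood base at $[x,r]$ with $r>0$ is given by the images of the neighbourhoods of $(x,r)$ in the product topology; at $\mathfrak o$ by the sets $\{[x,r]:0\le r<\varepsilon\}$, $\varepsilon>0$. $\mathfrak C[X]\times\mathfrak C[X]$ has the product topology. $\varrho^p$ radially $1$-homogeneous means $\varrho^p([x_1,\lambda r_1],[x_2,\lambda r_2])=\lambda\varrho^p([x_1,r_1],[x_2,r_2])$ for all $\lambda>0$, $x_i\in X$, $r_i\ge0$. $\mathfrak H^1(\mu_1,\mu_2)$ is the set of nonnegative finite Radon measures $\alpha$ on $\mathfrak C[X]\times\mathfrak C[X]$ with $\int(r_1+r_2)\,d\alpha<+\infty$ and $\mu_i(A)=\int_{\{r_i>0,\ x_i\in A\}}r_i\,d\alpha([x_1,r_1],[x_2,r_2])$ for every Borel $A\subset X$, $i=1,2$. *)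

(* Defs.v *)
From HB Require Import structures.
From mathcomp Require Import all_boot all_order all_algebra.
From mathcomp Require Import generic_quotient.
From mathcomp Require Import all_classical all_reals all_analysis.

Set Implicit Arguments.
Unset Strict Implicit.
Unset Printing Implicit Defensive.

Import Order.TTheory GRing.Theory Num.Theory.
Import numFieldNormedType.Exports.

Local Open Scope classical_set_scope.
Local Open Scope ring_scope.
Local Open Scope quotient_scope.

HB.instance Definition _ (T U : ptopologicalType) :=
  Pointed.on (T * U)%type.

(* [0, +oo[ with the topology induced by R *)
HB.instance Definition _ (R : realType) :=
  Topological.copy {nonneg R}
    (initial_topology (fun r : {nonneg R} => r%:num : R)).

Section cone_set.
Context (R : realType) (X : topologicalType).

Definition cone_rel (a b : X * {nonneg R}) : bool :=
  [&& a.1 == b.1, a.2 == b.2 & a.2%:num != 0] ||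
  ((a.2%:num == 0) && (b.2%:num == 0)).

Let cone_rel_refl : reflexive cone_rel.
Proof. by move=> a; rewrite /cone_rel !eqxx/= andbb orNb. Qed.

Let cone_rel_sym : symmetric cone_rel.
Proof.
move=> a b; rewrite /cone_rel (eq_sym a.1) (eq_sym a.2) [X in _ || X]andbC.
by case: (b.1 == a.1) => //=; case: eqVneq => //= ->.
Qed.

Let cone_rel_trans : transitive cone_rel.
Proof.
move=> [b1 b2] [a1 a2] [c1 c2]; rewrite /cone_rel/=.
move=> /orP[/and3P[/eqP-> /eqP-> //]|/andP[a0 b0]].
by rewrite a0 b0/= andbF/= => /orP[/andP[]|->]; rewrite ?orbT// andbF.
Qed.

Definition cone_equiv := EquivRel cone_rel cone_rel_refl cone_rel_sym
  cone_rel_trans.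

Definition cone := {eq_quot cone_equiv}.
HB.instance Definition _ := Choice.copy cone {eq_quot cone_equiv}.

Definition cone_pt (x : X) (r : {nonneg R}) : cone :=
  \pi_({eq_quot cone_equiv}) (x, r).

Definition cone_radius (c : cone) : {nonneg R} :=
  (repr (c : {eq_quot cone_equiv})).2.

(* only meaningful for [0 < cone_radius c]; some arbitrary point at the vertex *)
Definition cone_base (c : cone) : X := (repr (c : {eq_quot cone_equiv})).1.

Lemma cone_ptK (c : cone) : cone_pt (cone_base c) (cone_radius c) = c.
Proof. by rewrite /cone_pt -surjective_pairing reprK. Qed.

Lemma cone_pt_eqP x r y s : cone_pt x r = cone_pt y s <->
  [/\ x = y, r = s & s%:num != 0] \/ r%:num = 0 /\ s%:num = 0.
Proof.
split=> [/eqquotP|].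
  rewrite /= /cone_rel/= => /orP[/and3P[/eqP-> /eqP-> s0]|/andP[/eqP-> /eqP->]].
    by left.
  by right.
move=> [[-> -> //]|[r0 s0]].
by apply/eqquotP; rewrite /= /cone_rel/= r0 s0 eqxx orbT.
Qed.

Lemma cone_radius_pt x r : cone_radius (cone_pt x r) = r.
Proof.
have /cone_pt_eqP[[]//|[r0 s0]] := cone_ptK (cone_pt x r).
by apply/val_inj; rewrite /= r0 s0.
Qed.

Lemma cone_base_pt x r : 0 < r%:num -> cone_base (cone_pt x r) = x.
Proof.
move=> r0; have /cone_pt_eqP[[]//|[_ s0]] := cone_ptK (cone_pt x r).
by rewrite s0 ltxx in r0.
Qed.

(* in general strictly coarser at the vertex than the quotient topology *)
Definition cone_nbhs (c : cone) : set_system cone :=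
  if (cone_radius c)%:num == 0
  then filter_from [set e : R | 0 < e] (fun e => [set d | (cone_radius d)%:num < e])
  else (fun a => cone_pt a.1 a.2) @ nbhs (cone_base c, cone_radius c).

Let height_continuous : continuous (fun a : X * {nonneg R} => a.2%:num).
Proof.
move=> a; apply: (@continuous_comp _ _ _ snd (fun r : {nonneg R} => r%:num)).
  exact: cvg_snd.
exact: initial_continuous.
Qed.

Let cone_nbhs_filter (c : cone) : ProperFilter (cone_nbhs c).
Proof.
rewrite /cone_nbhs; case: ifPn => [/eqP c0|_]; last exact: fmap_proper_filter.
apply: filter_from_proper; last by move=> e e0; exists c; rewrite /= c0.
apply: filter_from_filter; first by exists 1 => /=.
move=> e f e0 f0; exists (Num.min e f); first by rewrite /= lt_min e0.
by move=> d /=; rewrite lt_min => /andP.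
Qed.

Let cone_nbhs_singleton (c : cone) (A : set cone) : cone_nbhs c A -> A c.
Proof.
rewrite /cone_nbhs; case: ifPn => [/eqP c0 [e e0]|_ /nbhs_singleton/=].
  by apply; rewrite /= c0.
by rewrite cone_ptK.
Qed.

Let cone_nbhs_nbhs (c : cone) (A : set cone) :
  cone_nbhs c A -> cone_nbhs c (cone_nbhs^~ A).
Proof.
rewrite [X in X -> _]/cone_nbhs [X in _ -> X]/cone_nbhs.
case: ifPn => [/eqP c0 [e e0 eA]|c0 cA].
  exists e => // d /= de; rewrite /cone_nbhs; case: ifPn => [_|d0].
    by exists e.
  have : nbhs (cone_base d, cone_radius d) [set a : X * {nonneg R} | a.2%:num < e].
    exact: (@height_continuous (cone_base d, cone_radius d) _ (lt_nbhsl de)).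
  by apply: filterS => -[x r] /= re; apply: eA; rewrite /= cone_radius_pt.
have {}c0 : 0 < (cone_radius c)%:num by rewrite lt_def c0/=.
have : nbhs (cone_base c, cone_radius c) [set a : X * {nonneg R} | 0 < a.2%:num].
  exact: (@height_continuous (cone_base c, cone_radius c) _ (lt_nbhsr c0)).
apply: filterS2 (nbhs_interior cA) => -[x r] /= xrA r0.
by rewrite /cone_nbhs cone_radius_pt cone_base_pt// gt_eqF.
Qed.

HB.instance Definition _ := hasNbhs.Build cone cone_nbhs.
HB.instance Definition _ := Nbhs_isNbhsTopological.Build cone
  cone_nbhs_filter cone_nbhs_singleton cone_nbhs_nbhs.

End cone_set.

Section cone_pointed.
Context (R : realType) (X : ptopologicalType).

(* well defined only for nonempty [X], hence the choice of a pointed type *)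
Definition vertex : cone R X := cone_pt point 0%:nng.

Lemma cone_pt0 (x : X) : cone_pt x 0%:nng = vertex.
Proof. by apply/cone_pt_eqP; right. Qed.

HB.instance Definition _ := isPointed.Build (cone R X) vertex.

End cone_pointed.

Definition separable_space (T : topologicalType) :=
  exists2 S : set T, countable S & dense S.

Notation borel T := (g_sigma_algebraType (@open T)).

Section measures.
Context (R : realType).

(* in a Hausdorff space [K] is closed, so [B `\` K] is Borel *)
Definition radon (T : ptopologicalType)
    (mu : {finite_measure set (borel T) -> \bar R}) : Prop :=
  forall B : set (borel T), measurable B ->
    forall e : R, 0 < e -> exists K : set T,
      [/\ compact K, K `<=` B & (mu (B `\` K) < e%:E)%E].

Definition weak_cvg (T : ptopologicalType)
    (mu_ : nat -> {finite_measure set (borel T) -> \bar R})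
    (mu : {finite_measure set (borel T) -> \bar R}) :=
  forall phi : T -> R, continuous phi -> bounded_fun phi ->
    (\int[mu_ n]_x (phi x)%:E)%E @[n --> \oo] --> (\int[mu]_x (phi x)%:E)%E.

Definition is_metric (T : Type) (d : T -> T -> R) :=
  [/\ forall x y, d x y = 0 <-> x = y,
      forall x y, d x y = d y x &
      forall x y z, d x z <= d x y + d y z].

Definition induces_topology (T : topologicalType) (d : T -> T -> R) :=
  forall x : T,
    nbhs x = filter_from [set e : R | 0 < e] (fun e => [set y | d x y < e]).

End measures.

Section cone_transport.
Context (R : realType) (X : ptopologicalType).

Definition radially_homogeneous (f : cone R X -> cone R X -> R) :=
  forall (l : {posnum R}) (x1 x2 : X) (r1 r2 : {nonneg R}),
    f (cone_pt x1 (l%:num * r1%:num)%:nng)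
      (cone_pt x2 (l%:num * r2%:num)%:nng) =
    l%:num * f (cone_pt x1 r1) (cone_pt x2 r2).

(* [i] is one of the two projections *)
Definition homogeneous_marginal
    (i : cone R X * cone R X -> cone R X)
    (alpha : {finite_measure set (borel (cone R X * cone R X)%type) -> \bar R})
    (mu : {finite_measure set (borel X) -> \bar R}) :=
  forall A : set (borel X), measurable A ->
    mu A = (\int[alpha]_(z in [set z | (0 < (cone_radius (i z))%:num)%R /\
                                       A (cone_base (i z))])
              ((cone_radius (i z))%:num)%:E)%E.

Definition homogeneous_plans
    (mu1 mu2 : {finite_measure set (borel X) -> \bar R}) :
    set {finite_measure set (borel (cone R X * cone R X)%type) -> \bar R} :=
  [set alpha | [/\ radon alpha,
    (\int[alpha]_z ((cone_radius z.1)%:num + (cone_radius z.2)%:num)%:E < +oo)%E,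
    homogeneous_marginal fst alpha mu1 &
    homogeneous_marginal snd alpha mu2]].

Variables (rho : cone R X -> cone R X -> R) (p : R).

Definition cone_transport_dist
    (mu1 mu2 : {finite_measure set (borel X) -> \bar R}) : \bar R :=
  ((ereal_inf [set \int[alpha]_z (rho z.1 z.2 `^ p)%:E
              | alpha in homogeneous_plans mu1 mu2]) `^ p^-1)%E.

Definition vertex_moment (mu : {finite_measure set (borel X) -> \bar R}) :
    \bar R :=
  (\int[mu]_x (rho (cone_pt x 1%:nng) (vertex R X) `^ p)%:E)%E.

Definition finite_moment_measures :
    set {finite_measure set (borel X) -> \bar R} :=
  [set mu | radon mu /\ (vertex_moment mu < +oo)%E].

End cone_transport.

Definition separable_for (R : realType) (T : Type) (M : set T)
    (d : T -> T -> \bar R) :=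
  exists S : set T, [/\ countable S, S `<=` M &
    forall x, M x -> forall e : R, 0 < e -> exists2 y, S y & (d x y < e%:E)%E].

(* Main.v *)
Require Import Defs.
From HB Require Import structures.
From mathcomp Require Import all_boot all_order all_algebra.
From mathcomp Require Import all_classical all_reals all_analysis measurable_realfun.
From mathcomp Require Import ring lra.
Import Order.TTheory GRing.Theory Num.Theory.
Import numFieldNormedType.Exports.
Local Open Scope classical_set_scope.
Local Open Scope ring_scope.

(** Since the sets of small radius are a neighbourhood base of the vertex [o] of
    the cone, the cost [h x = rho ([x,1], o) ^ p] lies between two positive
    constants, by homogeneity (vertex_cost_lb, vertex_cost_ub); it is moreover
    continuous. So weak convergence entails the convergence of the moments, and the
    statement reduces to the equivalence of convergence in the transport distance
    and of weak convergence. Also, [d x y = rho ([x,1], [y,1])] is a metric that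
    induces the topology of [X] (base_dist_metric, base_dist_topology).

    From transport to weak convergence. For a plan [alpha] between [nu] and [mu]
    and a bounded continuous [phi], the difference of the integrals of [phi] is
    the integral over [alpha] of [r1 phi(x1) - r2 phi(x2)]. By homogeneity the
    integrand can be examined on the slice [r2 = 1], where it is at most [e] for
    close points, as long as [x2] avoids a set of small [mu]-measure, and is
    bounded by a multiple of the cost for distant ones. So the difference is at
    most [t + L * cost], where [L] depends on [mu], [phi] and [t] only
    (homogeneous_plans_integral_close).

    From weak to transport convergence. A compact set carries almost all of [mu];
    take a partition of unity [psi_i] subordinate to a finite cover of it by small
    balls. With [a_i] and [b_i] the integrals of [psi_i] against [mu] and [nu],
    couple [psi_i mu] and [psi_i nu] by a product measure of mass
    [min a_i b_i] (matched_product_coupling), and send all that remains to, or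
    bring it from, the vertex (partial_coupling_plan). The first part moves mass
    inside small balls, and the second is small when the [b_i] and the total mass
    of [nu] are close to those of [mu] (finitely_many_tests). Two points need
    care. The Borel sigma-algebra of a product may be larger than the product of
    the Borel sigma-algebras when [X] is not separable; but Radon measures are
    carried by separable sets, on which the two agree (open_carrier_measurable).
    And the plan has to be Radon, which on a metric space amounts to tightness
    (tight_radon), inherited from [mu] and [nu].

    Separability. When [X] is separable the centres of the balls can be taken in
    a countable set, so that countably many tests, and rational approximations of
    their values, determine a measure up to a small transport distance. *)

Set Implicit Arguments.
Unset Strict Implicit.
Unset Printing Implicit Defensive.

(** * Densities and image measures *)

Section finite_measure_of.
Context d (T : measurableType d) (R : realType).
Variables (m : {measure set T -> \bar R}) (moo : (m setT < +oo)%E).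

(** A copy of [m], on which to declare the structure of a finite measure. *)
Definition finite_copy of (m setT < +oo)%E : set T -> \bar R := m.

HB.instance Definition _ := Measure.on (finite_copy moo).
HB.instance Definition _ := @Measure_isFinite.Build _ _ _ (finite_copy moo)
  (lty_fin_num_fun moo).

Lemma finite_measure_of :
  exists m' : {finite_measure set T -> \bar R}, forall A, m' A = m A.
Proof. by exists (finite_copy moo). Qed.

End finite_measure_of.

Lemma weighted_image_measure d1 d2 (T1 : measurableType d1)
    (T2 : measurableType d2) (R : realType) (m : {measure set T1 -> \bar R})
    (f : T1 -> T2) (w : T1 -> R) :
  measurable_fun setT f -> measurable_fun setT w -> (forall x, 0 <= w x) ->
  (\int[m]_x (w x)%:E < +oo)%E ->
  exists m' : {finite_measure set T2 -> \bar R}, forall A, measurable A ->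
    m' A = (\int[m]_(x in f @^-1` A) (w x)%:E)%E.
Proof.
move=> mf mw w0 woo.
have mpre A : measurable A -> measurable (f @^-1` A).
  by move=> mA; rewrite -[X in measurable X]setTI; exact: mf.
pose k := fun A : set T2 => (\int[m]_(x in f @^-1` A) (w x)%:E)%E.
have k0 : k set0 = 0%E by rewrite /k preimage_set0 integral_set0.
have kge0 A : (0 <= k A)%E by apply: integral_ge0 => x _; rewrite lee_fin.
have kadd : semi_sigma_additive k.
  move=> F mF tF mUF.
  rewrite [X in _ --> X](_ : _ = (\sum_(i <oo) k (F i))%E).
    by apply: is_cvg_ereal_nneg_natsum => n _; exact: kge0.
  rewrite /k preimage_bigcup ge0_integral_bigcup//.
  - by move=> i; exact: mpre.
  - by apply: measurable_funTS; exact/measurable_EFinP.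
  - by move=> x Dx; rewrite lee_fin.
  - apply/trivIsetP => /= i j iT jT ij; rewrite -preimage_setI.
    by move/trivIsetP : tF => /(_ _ _ iT jT ij) ->; rewrite preimage_set0.
pose H := isMeasure.Build _ _ _ k k0 kge0 kadd.
pose km : {measure set T2 -> \bar R} :=
  HB.pack_for {measure set T2 -> \bar R} k H.
have [] := finite_measure_of (m := km); first by rewrite /km/= /k preimage_setT.
by move=> m' m'E; exists m' => A _; rewrite m'E.
Qed.

Section integral_weighted_image.
Local Open Scope ereal_scope.
Context d1 d2 (T1 : measurableType d1) (T2 : measurableType d2) (R : realType).
Variables (m1 : {measure set T1 -> \bar R}) (m2 : {measure set T2 -> \bar R}).
Variables (f : T1 -> T2) (w : T1 -> R).
Hypotheses (mf : measurable_fun setT f) (mw : measurable_fun setT w).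
Hypothesis w0 : forall x, (0 <= w x)%R.
Hypothesis m2E : forall A, measurable A -> m2 A = \int[m1]_(x in f @^-1` A) (w x)%:E.

Let mpre A : measurable A -> measurable (f @^-1` A).
Proof. by move=> mA; rewrite -[X in measurable X]setTI; exact: mf. Qed.

Import HBNNSimple.

Let integral_weighted_image_nnsfun (g : {nnsfun T2 >-> R}) :
  \int[m2]_x (g x)%:E = \int[m1]_x ((g (f x))%:E * (w x)%:E).
Proof.
under eq_integral do rewrite fimfunE -fsumEFin//.
rewrite ge0_integral_fsum//; last 2 first.
- by move=> r; exact/measurable_EFinP/measurableT_comp.
- by move=> r x _; rewrite nnfun_muleindic_ge0.
have -> : \int[m1]_x ((g (f x))%:E * (w x)%:E) =
    \int[m1]_x (\sum_(r \in range g)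
      (r * \1_(g @^-1` [set r]) (f x))%:E * (w x)%:E).
  apply: eq_integral => x _; rewrite fimfunE -fsumEFin//.
  rewrite ge0_mule_fsuml// => r; exact: nnfun_muleindic_ge0.
rewrite ge0_integral_fsum//; last 2 first.
- move=> r; apply: emeasurable_funM; last exact/measurable_EFinP.
  apply/measurable_EFinP/measurable_funM => //.
  by apply: measurableT_comp.
- by move=> r x _; apply: mule_ge0; [exact: nnfun_muleindic_ge0|rewrite lee_fin].
apply: eq_fsbigr => r /[!inE] -[t _ gtr].
rewrite integralZl_indic_nnsfun// integral_indic// setIT m2E//.
rewrite integral_mkcond.
under [in RHS]eq_integral do rewrite EFinM -muleA.
have r0 : (0 <= r)%R by rewrite -gtr.
rewrite ge0_integralZl_EFin//; last 2 first.
- by move=> x _; rewrite mule_ge0 ?lee_fin.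
- by apply: emeasurable_funM; exact/measurable_EFinP/measurableT_comp.
congr (_ * _); apply: eq_integral => x _; rewrite patchE indicE.
rewrite (_ : (x \in _) = (f x \in g @^-1` [set r])); last first.
  by apply/idP/idP; rewrite !inE.
by case: ifPn => _; rewrite (mul1e, mul0e).
Qed.

(** The formula holds for indicators by the hypothesis on [m2], hence for simple
    functions, and passes to the limit by monotone convergence. *)
Lemma ge0_integral_weighted_image (g : T2 -> \bar R) :
  measurable_fun setT g -> (forall y, 0 <= g y) ->
  \int[m2]_y g y = \int[m1]_x (g (f x) * (w x)%:E).
Proof.
move=> mg g0.
pose g_ := nnsfun_approx measurableT mg.
have g_ge0 n y : (0 <= g_ n y)%R by exact: fun_ge0.
have g_cvg y : (g_ n y)%:E @[n --> \oo] --> g y by exact: cvg_nnsfun_approx.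
have g_nd y : {homo (fun n => (g_ n y)%:E) : n m / (n <= m)%N >-> n <= m}.
  by move=> n m nm; rewrite lee_fin; exact/lefP/nd_nnsfun_approx.
transitivity (limn (fun n => \int[m2]_y (g_ n y)%:E)).
  rewrite -monotone_convergence//.
  - by apply: eq_integral => y _; apply/esym/cvg_lim => //.
  - by move=> n; exact/measurable_EFinP.
  - by move=> n y yT; rewrite lee_fin.
under [X in limn X = _]eq_fun do rewrite integral_weighted_image_nnsfun.
rewrite -monotone_convergence//.
- apply: eq_integral => x _; apply/cvg_lim => //.
  by apply: cvgeZr.
- move=> n; apply: emeasurable_funM; last exact/measurable_EFinP.
  by apply/measurable_EFinP/measurableT_comp.
- by move=> n x _; rewrite mule_ge0 ?lee_fin.
- by move=> x _ n m nm; rewrite lee_wpmul2r ?lee_fin// -lee_fin g_nd.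
Qed.

Lemma integral_weighted_image (g : T2 -> \bar R) : measurable_fun setT g ->
  \int[m2]_y g y = \int[m1]_x (g (f x) * (w x)%:E).
Proof.
move=> mg; rewrite integralE [RHS]integralE.
rewrite !ge0_integral_weighted_image//; last 2 first.
- exact: measurable_funeneg.
- exact: measurable_funepos.
congr (_ - _); apply: eq_integral => x _.
- by rewrite !funeposE [LHS]muleC maxe_pMr ?lee_fin// mule0 muleC.
- by rewrite !funenegE [LHS]muleC maxe_pMr ?lee_fin// mule0 muleC mulNe.
Qed.

End integral_weighted_image.

(** * Borel measurability *)

Lemma open_borel (T : ptopologicalType) (A : set (borel T)) :
  open (A : set T) -> measurable A.
Proof. exact: sub_gen_smallest. Qed.

Lemma closed_borel (T : ptopologicalType) (A : set (borel T)) :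
  closed (A : set T) -> measurable A.
Proof. by move=> /closed_openC/open_borel/measurableC; rewrite setCK. Qed.

Lemma measurable_fun_borel d (S : measurableType d) (T : ptopologicalType)
    (f : S -> borel T) :
  (forall U : set T, open U -> measurable (f @^-1` U)) -> measurable_fun setT f.
Proof.
move=> fU; have bE : @measurable _ (borel T) = <<s @open T >> by [].
apply: (measurability _ bE).
by move=> _ [U oU <-]; rewrite setTI; exact: fU.
Qed.

Lemma continuous_measurable_borel (S T : ptopologicalType) (f : S -> T) :
  continuous f -> measurable_fun setT (f : borel S -> borel T).
Proof.
move=> /continuousP fc; apply: measurable_fun_borel => U oU.
by apply: open_borel; exact: fc.
Qed.

Lemma continuous_measurable_real (R : realType) (T : ptopologicalType)
    (f : T -> R) :
  continuous f -> measurable_fun setT (f : borel T -> R).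
Proof.
move=> /continuousP fc; apply: (measurability _ (RGenOpens.measurableE R)).
move=> _ [_ [a [b ->] <-]]; rewrite setTI; apply: open_borel.
exact/fc/interval_open.
Qed.

(** * Finite Borel measures on metric spaces *)

Lemma exists_natV_lt (R : realType) (e : R) : 0 < e -> exists n, n.+1%:R^-1 < e.
Proof.
move=> e0; have /filter_ex[n ne] := near_infty_natSinv_lt (PosNum e0).
by exists n.
Qed.

Section metric.
Context (R : realType) (T : ptopologicalType) (d : T -> T -> R).
Hypotheses (dm : is_metric d) (dt : induces_topology d).

Lemma metric_xx x : d x x = 0.
Proof. by case: dm => h _ _; apply/h. Qed.

Lemma metric_sym x y : d x y = d y x. Proof. by case: dm. Qed.

Lemma metric_triangle y x z : d x z <= d x y + d y z. Proof. by case: dm. Qed.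

Lemma metric_ge0 x y : 0 <= d x y.
Proof.
have := metric_triangle y x x; rewrite metric_xx (metric_sym y x); lra.
Qed.

Lemma nbhs_metric x e : 0 < e -> nbhs x [set y | d x y < e].
Proof. by move=> e0; rewrite dt; exists e. Qed.

Lemma open_metric x e : open [set y | d x y < e].
Proof.
rewrite openE => y /= xye; rewrite /interior dt; exists (e - d x y).
  by rewrite /= subr_gt0.
by move=> z /=; have := metric_triangle y x z; lra.
Qed.

Lemma metric_continuous2 : continuous (fun z : T * T => d z.1 z.2).
Proof.
move=> [x y]; apply/cvgrPdist_lt => e e0 /=.
have e20 : 0 < e / 2 by rewrite divr_gt0.
exists ([set u | d x u < e / 2], [set v | d y v < e / 2]).
  by split; exact: nbhs_metric.
move=> [u v] /= [xu yv].
have h1 := metric_triangle u x y; have h2 := metric_triangle v u y.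
have h3 := metric_triangle x u v; have h4 := metric_triangle y x v.
rewrite ltr_norml; rewrite (metric_sym v y) in h2; rewrite (metric_sym u x) in h3.
by apply/andP; split; lra.
Qed.

Lemma metric_continuousr x : continuous (d x).
Proof.
move=> y; apply: (@continuous_comp _ _ _ (fun y => (x, y))
  (fun z : T * T => d z.1 z.2)).
  by apply: cvg_pair => //; exact: cvg_cst.
exact: metric_continuous2.
Qed.

Lemma metric_hausdorff : hausdorff_space T.
Proof.
move=> x y xy; apply: contrapT => /eqP nxy.
have d0 : 0 < d x y.
  rewrite lt_neqAle metric_ge0 andbT eq_sym; apply: contra nxy => /eqP.
  by case: dm => h _ _ /h /eqP.
have d20 : 0 < d x y / 2 by rewrite divr_gt0.
have [z /= [xz yz]] := xy _ _ (nbhs_metric x d20) (nbhs_metric y d20).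
by have := metric_triangle z x y; rewrite (metric_sym z y); lra.
Qed.

(** The n-th closed set collects the points at distance at least 1/(n+1) from
    the complement of [U]. *)
Lemma open_Fsigma (U : set T) : open U -> exists F : nat -> set T,
  [/\ forall n, closed (F n), {homo F : m n / (m <= n)%N >-> m `<=` n} &
      U = \bigcup_n F n].
Proof.
move=> oU.
pose F n := [set x | forall y, ~ U y -> n.+1%:R^-1 <= d y x].
exists F; split.
- move=> n; rewrite -(setCK (F n)); apply: open_closedC.
  rewrite (_ : ~` F n =
      \bigcup_(y in ~` U) [set x | d y x < n.+1%:R^-1]).
    by apply: bigcup_open => y _; exact: open_metric.
  apply/seteqP; split=> x /=.
    move=> /existsNP[y] /not_implyP[Uy] /negP; rewrite -ltNge => h.
    by exists y.
  by move=> [y Uy h] /(_ y Uy); rewrite leNgt h.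
- move=> m n mn x Fx y /Fx; apply: le_trans.
  by rewrite lef_pV2 ?posrE// ler_nat.
- apply/seteqP; split=> x.
    move=> Ux; have : nbhs x U by exact: open_nbhs_nbhs.
    rewrite dt => -[e /= e0 eU].
    have [n ne] := exists_natV_lt e0.
    exists n => // y Uy; rewrite leNgt; apply/negP => yx; apply/Uy/eU => /=.
    by rewrite metric_sym (lt_trans yx).
  move=> [n _ Fx]; apply: contrapT => /Fx; rewrite metric_xx leNgt.
  by rewrite invr_gt0 ltr0n.
Qed.

Section closed_regularity.
Variable mu : {finite_measure set (borel T) -> \bar R}.

(* a closed and an open set are asked for together because complementation
   exchanges them *)
Let squeezed (A : set T) := forall e : R, 0 < e -> exists F U : set T,
  [/\ closed F, open U, F `<=` A, A `<=` U & (mu (U `\` F) < e%:E)%E].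

Let mu_fin (A : set (borel T)) : measurable A -> (mu A < +oo)%E.
Proof. by move=> mA; rewrite ltey_eq fin_num_measure. Qed.

Let squeezed_open U : open U -> squeezed U.
Proof.
move=> oU e e0; have [F [cF ndF UE]] := open_Fsigma oU.
have : (mu \o (fun n => U `\` F n)) n @[n --> \oo] -->
    mu (\bigcap_n (U `\` F n)).
  apply: nonincreasing_cvg_mu.
  - by apply: mu_fin; apply: measurableD; [exact: open_borel|exact: closed_borel].
  - by move=> n; apply: measurableD; [exact: open_borel|exact: closed_borel].
  - apply: bigcapT_measurable => n.
    by apply: measurableD; [exact: open_borel|exact: closed_borel].
  - by move=> m n mn; apply/subsetPset; apply: setDS; exact: ndF.
rewrite (_ : \bigcap_n _ = set0) ?measure0; last first.
  apply/seteqP; split => // x h.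
  have [+ _] := h 0%N I; rewrite UE => -[n _ Fx].
  by have [_ /(_ Fx)] := h n I.
rewrite -[X in _ --> X]/(0%:E).
move=> /fine_cvgP[fin /cvgrPdist_lt/(_ e e0) small].
have [n [/= nfin nsmall]] := filter_ex (filterI fin small).
exists (F n), U; split => //; first by rewrite UE; exact: bigcup_sup.
move: nsmall; rewrite sub0r normrN -lte_fin => h; rewrite -(fineK nfin).
by rewrite (le_lt_trans _ h)// lee_fin ler_norm.
Qed.

Let squeezedC A : squeezed A -> squeezed (~` A).
Proof.
move=> sA e e0; have [F [U [cF oU FA AU h]]] := sA e e0.
exists (~` U), (~` F); split; [exact: open_closedC|exact: closed_openC| | |].
- exact: subsetC.
- exact: subsetC.
- by rewrite setDE setCK setIC -setDE.
Qed.

Let squeezed_bigcup (A : nat -> set T) :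
  (forall n, squeezed (A n)) -> squeezed (\bigcup_n A n).
Proof.
move=> sA e e0; have e20 : 0 < e / 2 by rewrite divr_gt0.
(* an error [e / 2 / 2 ^ n.+1] for the n-th set; the other half of [e] leaves
   room to replace the union of the closed sets by a finite, closed, one *)
have /choice[FU FUP] : forall n, exists FU : set T * set T,
    [/\ closed FU.1, open FU.2, FU.1 `<=` A n, A n `<=` FU.2 &
      (mu (FU.2 `\` FU.1) < (e / 2 / (2 ^ n.+1)%:R)%:E)%E].
  move=> n; have [|F [U h]] := sA n (e / 2 / (2 ^ n.+1)%:R).
    by rewrite divr_gt0// ltr0n expn_gt0.
  by exists (F, U).
pose F n := (FU n).1; pose U n := (FU n).2.
have cF n : closed (F n) by case: (FUP n).
have oU n : open (U n) by case: (FUP n).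
have FA n : F n `<=` A n by case: (FUP n).
have AU n : A n `<=` U n by case: (FUP n).
have mUF n : measurable (U n `\` F n : set (borel T)).
  by apply: measurableD; [exact: open_borel|exact: closed_borel].
have oUU : open (\bigcup_n U n) by apply: bigcup_open => n _; exact: oU.
pose G n := \big[setU/set0]_(i < n) F i.
have cG n : closed (G n) by apply: closed_bigsetU => i _; exact: cF.
have mG n : measurable (\bigcup_n U n `\` G n : set (borel T)).
  by apply: measurableD; [exact: open_borel|exact: closed_borel].
have lim_small : (mu (\bigcap_n (\bigcup_n U n `\` G n)) < e%:E)%E.
  apply: (@le_lt_trans _ _ (\sum_(n <oo) mu (U n `\` F n))%E).
    apply: measure_sigma_subadditive => //.
      by apply: bigcapT_measurable.
    move=> x h; have [[n _ Ux] _] := h 0%N I; exists n => //; split => //.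
    have [_ + Fx] := h n.+1 I; apply; rewrite /G big_ord_recr/=; right.
    exact: Fx.
  apply: (@le_lt_trans _ _ (\sum_(n <oo) (0 + (e / 2 / (2 ^ n.+1)%:R)%:E))%E).
    apply: lee_nneseries => [n _ //|n _]; rewrite add0e.
    by case: (FUP n) => _ _ _ _ /ltW.
  apply: (le_lt_trans (epsilon_trick _ _ (ltW e20))) => //.
  rewrite eseries0// add0e lte_fin ltr_pdivrMr//; lra.
have limfin : mu (\bigcap_n (\bigcup_n U n `\` G n)) \is a fin_num.
  by rewrite fin_num_measure//; exact: bigcapT_measurable.
have : (mu \o (fun n => \bigcup_n U n `\` G n)) n @[n --> \oo] -->
    mu (\bigcap_n (\bigcup_n U n `\` G n)).
  apply: nonincreasing_cvg_mu => //.
  - exact: mu_fin.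
  - exact: bigcapT_measurable.
  - move=> m n mn; apply/subsetPset; apply: setDS.
    exact: subset_bigsetU.
rewrite -[X in _ --> X](fineK limfin) => /fine_cvgP[fin].
rewrite -(fineK limfin) lte_fin in lim_small.
move=> /cvgr_lt /(_ _ lim_small) small.
have [n [/= nfin nsmall]] := filter_ex (filterI fin small).
exists (G n), (\bigcup_n U n); split => //.
- apply: (@subset_trans _ (\bigcup_n F n)).
    by rewrite /G -bigcup_mkord => x [i _ Fx]; exists i.
  by move=> x [i _ Fx]; exists i => //; exact: FA.
- by move=> x [i _ Ax]; exists i => //; exact: AU.
- by rewrite -(fineK nfin) lte_fin.
Qed.

(** The sets that can be squeezed between a closed and an open set up to an
    arbitrarily small measure form a sigma-algebra, which contains the open sets
    since these are countable unions of closed ones. *)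
Lemma finite_borel_measure_closed_regular (A : set (borel T)) : measurable A ->
  forall e : R, 0 < e -> exists F : set T,
    [/\ closed F, F `<=` A & (mu (A `\` F) < e%:E)%E].
Proof.
move=> mA; have sA : squeezed A.
  move: A mA; apply: smallest_sub; last exact: squeezed_open.
  split; first by apply: squeezed_open; exact: open0.
  - by move=> A sA; rewrite setTD; exact: squeezedC.
  - by move=> F sF; exact: squeezed_bigcup.
move=> e e0; have [F [U [cF oU FA AU h]]] := sA e e0.
exists F; split => //; apply: le_lt_trans h; apply: le_measure; rewrite ?inE.
- by apply: measurableD => //; exact: closed_borel.
- by apply: measurableD; [exact: open_borel|exact: closed_borel].
- exact: setSD.
Qed.

End closed_regularity.

(** A closed set given by regularity becomes compact after intersection with a
    compact set of almost full measure. *)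
Lemma tight_radon (mu : {finite_measure set (borel T) -> \bar R}) :
  (forall e : R, 0 < e -> exists K : set T,
    compact K /\ (mu (~` K : set (borel T)) < e%:E)%E) -> radon mu.
Proof.
move=> tight B mB e e0; have e20 : 0 < e / 2 by rewrite divr_gt0.
have [F [cF FB hF]] := finite_borel_measure_closed_regular mu mB e20.
have [K [cK hK]] := tight _ e20.
have mK : measurable (K : set (borel T)).
  by apply: closed_borel; apply: compact_closed cK; exact: metric_hausdorff.
have mF : measurable (F : set (borel T)) by exact: closed_borel.
exists (K `&` F); split; [exact: compact_closedI|by move=> x [_ /FB]|].
rewrite [e]splitr EFinD; apply: le_lt_trans (lteD hF hK).
apply: (@le_trans _ _ (mu ((B `\` F) `|` ~` K))).
  apply: le_measure; rewrite ?inE.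
  - by apply: measurableD => //; apply: measurableI.
  - by apply: measurableU; [exact: measurableD|exact: measurableC].
  - move=> x [Bx KFx]; have [Kx|nKx] := pselect (K x); [left|by right].
    by split => // Fx; apply: KFx.
by apply: measureU2; [exact: measurableD|exact: measurableC].
Qed.

End metric.

(** * Radon measures are carried by separable sets *)

Section radon_separability.
Context (R : realType) (T : ptopologicalType) (d : T -> T -> R).
Hypotheses (dm : is_metric d) (dt : induces_topology d).

Lemma compact_net (K D : set T) (e : R) : compact K -> 0 < e ->
  (forall x, exists2 y, D y & d y x < e) ->
  exists2 s : seq T, (forall y, y \in s -> D y) &
    forall x, K x -> exists2 y, y \in s & d y x < e.
Proof.
rewrite compact_cover => cK e0 Dd.
have [||s sD Ks] := cK T D (fun y => [set x | d y x < e]).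
- by move=> y _; exact: (open_metric dm dt).
- by move=> x _; have [y Dy yx] := Dd x; exists y.
exists (finmap.enum_fset s) => [y ys|x /Ks[y /= ys yx]]; last by exists y.
by have := sD _ ys; rewrite inE.
Qed.

(** A Radon measure lives on a countable union of compact sets, and compact
    metric spaces are separable. *)
Lemma radon_carrier (mu : {finite_measure set (borel T) -> \bar R}) :
  radon mu -> exists (S : set T) (y : nat -> T),
    [/\ measurable (S : set (borel T)), mu (~` S) = 0 &
        forall x, S x -> forall e : R, 0 < e -> exists n, d (y n) x < e].
Proof.
move=> rmu.
have /choice[K KP] : forall n, exists K : set T, compact K /\
    (mu (~` K : set (borel T)) < (n.+1%:R^-1)%:E)%E.
  move=> n; have [//||K [cK _ h]] := rmu setT _ n.+1%:R^-1.
    by rewrite invr_gt0.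
  by exists K; split => //; rewrite -setTD.
have /choice[s sP] : forall nm : nat * nat, exists s : seq T,
    forall x, K nm.1 x -> exists2 y, y \in s & d y x < nm.2.+1%:R^-1.
  move=> [n m] /=; have [| |s _ sK] := @compact_net (K n) setT m.+1%:R^-1 (KP n).1.
  - by rewrite invr_gt0.
  - by move=> x; exists x => //; rewrite (metric_xx dm) invr_gt0.
  - by exists s.
have mK n : measurable (K n : set (borel T)).
  apply: closed_borel; apply: compact_closed (KP n).1.
  exact: metric_hausdorff dm dt.
have mS : measurable (\bigcup_n K n : set (borel T)) by exact: bigcupT_measurable.
exists (\bigcup_n K n), (fun k => if unpickle k is Some (nm, i) then
  nth point (s nm) i else point); split => //.
  apply/eqP; rewrite eq_le measure_ge0 andbT; apply/lee_addgt0Pr => e e0.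
  have [n ne] := exists_natV_lt e0; rewrite add0e.
  apply: (@le_trans _ _ (mu (~` K n))).
    apply: le_measure; rewrite ?inE; [exact: measurableC|exact: measurableC|].
    by apply: subsetC; exact: bigcup_sup.
  by rewrite (le_trans (ltW (KP n).2))// lee_fin ltW.
move=> x [n _ Kx] e e0; have [m me] := exists_natV_lt e0.
have [y ys yx] := sP (n, m) x Kx.
exists (pickle ((n, m), index y (s (n, m)))); rewrite pickleK nth_index//.
exact: lt_trans me.
Qed.

Lemma radon_common_carrier (mu nu : {finite_measure set (borel T) -> \bar R}) :
  radon mu -> radon nu -> exists (S : set T) (y : nat -> T),
    [/\ measurable (S : set (borel T)), mu (~` S) = 0, nu (~` S) = 0 &
        forall x, S x -> forall e : R, 0 < e -> exists n, d (y n) x < e].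
Proof.
move=> /radon_carrier[S1 [y1 [mS1 mu0 y1P]]] /radon_carrier[S2 [y2 [mS2 nu0 y2P]]].
exists (S1 `|` S2), (fun k => if odd k then y1 k./2 else y2 k./2); split.
- exact: measurableU.
- apply: (subset_measure0 _ _ _ mu0); [|exact: measurableC|].
    by apply: measurableC; exact: measurableU.
  by apply: subsetC => x; left.
- apply: (subset_measure0 _ _ _ nu0); [|exact: measurableC|].
    by apply: measurableC; exact: measurableU.
  by apply: subsetC => x; right.
- move=> x [Sx|Sx] e e0.
    have [n nx] := y1P x Sx e e0; exists n.*2.+1.
    by rewrite /= odd_double/= uphalf_double.
  have [n nx] := y2P x Sx e e0; exists n.*2.
  by rewrite /= odd_double/= doubleK.
Qed.

Section restrict_to_carrier.
Variables (S : set T) (y : nat -> T).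
Hypothesis mS : measurable (S : set (borel T)).
Hypothesis yP : forall x, S x -> forall e : R, 0 < e -> exists n, d (y n) x < e.

(** The product of two Borel sigma-algebras may fail to contain the open sets
    of the product topology, but it does contain their traces on a separable
    square, which are countable unions of rectangles. *)
Lemma open_carrier_measurable (U : set (T * T)) : open U ->
  measurable (U `&` (S `*` S) : set (borel T * borel T)).
Proof.
move=> oU; pose B k n := [set x | d (y k) x < n.+1%:R^-1].
pose F (i : nat * nat * nat) : set (T * T) :=
  if `[< B i.1.1 i.2 `*` B i.1.2 i.2 `<=` U >]
  then (B i.1.1 i.2 `&` S) `*` (B i.1.2 i.2 `&` S) else set0.
rewrite (_ : U `&` _ = \bigcup_i F i).
  apply: countable_bigcupT_measurable => // -[[k l] n]; rewrite /F/=.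
  case: ifPn => // _; apply: measurableX; apply: measurableI => //;
    by apply: open_borel; exact: (open_metric dm dt).
apply/seteqP; split=> [[a b] [Uab [Sa Sb]]|[a b] [[[k l] n] _]]; last first.
  by rewrite /F/=; case: ifPn => // /asboolP BU [[ka Sa] [lb Sb]]; split => //;
    exact: BU.
have : nbhs (a, b) U by exact: open_nbhs_nbhs.
move=> [[V W] [/= Va Wb] VW].
move: Va Wb; rewrite !dt => -[e /= e0 eV] [f /= f0 fW].
have m0 : 0 < Num.min e f / 2 by rewrite divr_gt0// lt_min e0.
have [n nm] := exists_natV_lt m0.
have n0 : 0 < n.+1%:R^-1 :> R by rewrite invr_gt0.
have [k ka] := yP Sa n0; have [l lb] := yP Sb n0.
have nef : n.+1%:R^-1 + n.+1%:R^-1 < Num.min e f.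
  by move: nm; rewrite ltr_pdivlMr// mulr_natr mulr2n.
move: (nef); rewrite lt_min => /andP[ne nf].
exists (k, l, n) => //; rewrite /F/= asboolT//= => -[a' b'] [/= ka' lb'].
apply: VW; split => /=.
  apply: eV => /=; apply: le_lt_trans (metric_triangle dm (y k) _ _) _.
  by rewrite (metric_sym dm a); apply: lt_trans ne; exact: ltrD.
apply: fW => /=; apply: le_lt_trans (metric_triangle dm (y l) _ _) _.
by rewrite (metric_sym dm b); apply: lt_trans nf; exact: ltrD.
Qed.

(** The identity on the square of the carrier, made measurable on the whole
    product sigma-algebra by collapsing the null complement to one point. *)
Definition to_carrier (z : borel T * borel T) : borel (T * T)%type :=
  if `[< (S `*` S) z >] then z else point.

Lemma measurable_to_carrier : measurable_fun setT to_carrier.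
Proof.
have mSS : measurable (S `*` S : set (borel T * borel T)) by exact: measurableX.
apply: measurable_fun_borel => U oU.
rewrite (_ : _ @^-1` _ = (U `&` (S `*` S)) `|`
    (if `[< U point >] then ~` (S `*` S) else set0)).
  apply: measurableU; first exact: open_carrier_measurable.
  by case: ifPn => // _; exact: measurableC.
apply/seteqP; split=> z; rewrite /preimage/= /to_carrier.
  case: ifPn => [/asboolP h|/asboolPn h] Uz; [by left|right].
  by rewrite asboolT.
case=> [[Uz h]|]; first by rewrite asboolT.
by case: ifPn => // /asboolP Up h; rewrite asboolF.
Qed.

End restrict_to_carrier.
End radon_separability.

(** * Couplings that move mass only within small sets *)

Lemma measurable_borel_fst (T U : ptopologicalType) :
  measurable_fun setT (fst : borel (T * U)%type -> borel T).
Proof.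
have h : continuous (fst : T * U -> T) by move=> z; exact: cvg_fst.
exact: continuous_measurable_borel h.
Qed.

Lemma measurable_borel_snd (T U : ptopologicalType) :
  measurable_fun setT (snd : borel (T * U)%type -> borel U).
Proof.
have h : continuous (snd : T * U -> U) by move=> z; exact: cvg_snd.
exact: continuous_measurable_borel h.
Qed.

Lemma measurable_fst_preimage (T U : ptopologicalType) (A : set (borel T)) :
  measurable A -> measurable (fst @^-1` A : set (borel (T * U)%type)).
Proof.
move=> mA; rewrite -[X in measurable X]setTI.
exact: (@measurable_borel_fst T U).
Qed.

Lemma measurable_snd_preimage (T U : ptopologicalType) (A : set (borel U)) :
  measurable A -> measurable (snd @^-1` A : set (borel (T * U)%type)).
Proof.
move=> mA; rewrite -[X in measurable X]setTI.
exact: (@measurable_borel_snd T U).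
Qed.

Section matched_product_coupling.
Context (R : realType) (T : ptopologicalType) (d : T -> T -> R).
Hypotheses (dm : is_metric d) (dt : induces_topology d).
Variables (mu nu : {finite_measure set (borel T) -> \bar R}).
Hypotheses (rmu : radon mu) (rnu : radon nu).
Variables (I : Type) (s : seq I) (psi : I -> T -> R).
Hypothesis mpsi : forall i, measurable_fun setT (psi i : borel T -> R).
Hypothesis psi0 : forall i x, 0 <= psi i x.
Hypothesis psi_sum : forall x, \sum_(i <- s) psi i x <= 1.
Variables (a b : I -> R).
Hypothesis aE : forall i, (\int[mu]_x (psi i x)%:E = (a i)%:E)%E.
Hypothesis bE : forall i, (\int[nu]_x (psi i x)%:E = (b i)%:E)%E.

Let a0 i : 0 <= a i.
Proof.
by rewrite -lee_fin -aE; apply: integral_ge0 => x _; rewrite lee_fin.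
Qed.

Let b0 i : 0 <= b i.
Proof.
by rewrite -lee_fin -bE; apply: integral_ge0 => x _; rewrite lee_fin.
Qed.

(* with [0^-1 = 0] the weight vanishes when one of the pieces has no mass *)
Let k i := Num.min (a i) (b i) / (a i * b i).

Let k0 i : 0 <= k i.
Proof. by rewrite divr_ge0 ?mulr_ge0// le_min a0 b0. Qed.

Let ka1 i : k i * a i <= 1.
Proof.
rewrite /k; have [->|an0] := eqVneq (a i) 0; first by rewrite mulr0.
have [->|bn0] := eqVneq (b i) 0; first by rewrite mulr0 invr0 mulr0 mul0r.
rewrite (_ : _ * a i = Num.min (a i) (b i) / b i); last first.
  by field; rewrite an0 bn0.
by rewrite ler_pdivrMr ?lt_def ?bn0 ?b0// mul1r ge_min lexx orbT.
Qed.

Let kb1 i : k i * b i <= 1.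
Proof.
rewrite /k; have [->|an0] := eqVneq (a i) 0; first by rewrite mul0r invr0 mulr0 mul0r.
have [->|bn0] := eqVneq (b i) 0; first by rewrite mulr0.
rewrite (_ : _ / _ * b i = Num.min (a i) (b i) / a i); last first.
  by field; rewrite an0 bn0.
by rewrite ler_pdivrMr ?lt_def ?an0 ?a0// mul1r ge_min lexx.
Qed.

Let kab i : k i * a i * b i = Num.min (a i) (b i).
Proof.
rewrite /k; have [a_0|an0] := eqVneq (a i) 0.
  by rewrite a_0 mulr0 mul0r min_l.
have [b_0|bn0] := eqVneq (b i) 0; first by rewrite b_0 mulr0 min_r.
by rewrite -mulrA mulfVK// mulf_neq0.
Qed.

Local Ltac nonneg :=
  do ?[exact: k0 | exact: a0 | exact: b0 | by [] | apply: mulr_ge0].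

(** Spreading the mass [min (a i) (b i)] over the product of the normalized
    pieces [psi i * mu] and [psi i * nu], for each index, yields a coupling of
    the parts [u * mu] and [v * nu] of [mu] and [nu]. It is carried by the
    squares of the supports of the [psi i], so that it moves mass only within
    a support. *)
Lemma matched_product_coupling :
  exists (pi : {finite_measure set (borel (T * T)%type) -> \bar R})
         (u v : T -> R),
  [/\ measurable_fun setT (u : borel T -> R) /\ (forall x, 0 <= u x <= 1),
      measurable_fun setT (v : borel T -> R) /\ (forall x, 0 <= v x <= 1),
      (forall A : set (borel T), measurable A ->
        pi (fst @^-1` A) = \int[mu]_(x in A) (u x)%:E /\
        pi (snd @^-1` A) = \int[nu]_(x in A) (v x)%:E)%E,
      pi setT = (\sum_(i <- s) Num.min (a i) (b i))%:E &
      forall (g : T * T -> R) (t : R),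
        measurable_fun setT (g : borel (T * T)%type -> R) ->
        (forall z, 0 <= g z) -> 0 <= t ->
        (forall i x y, psi i x != 0 -> psi i y != 0 -> g (x, y) <= t) ->
        (\int[pi]_z (g z)%:E <= t%:E * pi setT)%E].
Proof.
have [S [y [mS muS nuS yP]]] := radon_common_carrier dm dt rmu rnu.
(* the two measures do not charge the complement of the separable set [S], and
   on [S] the product sigma-algebra contains the Borel sets of the product *)
pose phi i x := psi i x * \1_S x.
have phi0 i x : 0 <= phi i x by rewrite mulr_ge0.
have phi_le i x : phi i x <= psi i x.
  by rewrite /phi indicE; case: (x \in S); rewrite ?mulr1// mulr0.
have mphi i : measurable_fun setT (phi i : borel T -> R).
  by apply: measurable_funM => //; exact: measurable_indic.
have int_phi (m : {finite_measure set (borel T) -> \bar R}) i :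
    m (~` S) = 0 -> (\int[m]_x (phi i x)%:E = \int[m]_x (psi i x)%:E)%E.
  move=> mS0.
  rewrite [RHS](ge0_negligible_integral _ _ _ _ mS0)//; last 3 first.
  - exact: measurableC.
  - exact/measurable_EFinP.
  - by move=> x _; rewrite lee_fin.
  rewrite [RHS]integral_mkcond setTD setCK; apply: eq_integral => x _.
  by rewrite patchE /phi indicE; case: ifPn; rewrite ?mulr1// mulr0.
have int_sum (m : {finite_measure set (borel T) -> \bar R}) (c e : I -> R) :
    (forall i, 0 <= c i) -> (forall i, \int[m]_x (phi i x)%:E = (e i)%:E)%E ->
    (\int[m]_x (\sum_(i <- s) c i * phi i x)%:E = (\sum_(i <- s) c i * e i)%:E)%E.
  move=> c0 me; under eq_integral do rewrite -sumEFin.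
  rewrite ge0_integral_sum//; last 2 first.
  - by move=> i; apply/measurable_EFinP/measurable_funM.
  - by move=> i x _; rewrite lee_fin mulr_ge0.
  rewrite -sumEFin; apply: eq_bigr => i _.
  under eq_integral do rewrite EFinM.
  rewrite ge0_integralZl_EFin// ?me//.
  - by move=> x _; rewrite lee_fin.
  - exact/measurable_EFinP.
have phia i : (\int[mu]_x (phi i x)%:E = (a i)%:E)%E by rewrite int_phi.
have phib i : (\int[nu]_x (phi i x)%:E = (b i)%:E)%E by rewrite int_phi.
pose w (z : borel T * borel T) := \sum_(i <- s) k i * (phi i z.1 * phi i z.2).
have w0 z : 0 <= w z.
  apply: sumr_ge0 => i _. nonneg.
have mw : measurable_fun setT w.
  apply: measurable_sum => i; apply: measurable_funM => //.
  by apply: measurable_funM; apply: measurableT_comp.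
pose u x := \sum_(i <- s) k i * b i * phi i x.
pose v x := \sum_(i <- s) k i * a i * phi i x.
have meas_u : measurable_fun setT (u : borel T -> R).
  by apply: measurable_sum => i; apply: measurable_funM.
have meas_v : measurable_fun setT (v : borel T -> R).
  by apply: measurable_sum => i; apply: measurable_funM.
have u01 x : 0 <= u x <= 1.
  apply/andP; split; first by apply: sumr_ge0 => i _; nonneg.
  apply: le_trans (psi_sum x); apply: ler_sum => i _.
  apply: le_trans (phi_le _ _).
  by rewrite -[leRHS]mul1r ler_wpM2r.
have v01 x : 0 <= v x <= 1.
  apply/andP; split; first by apply: sumr_ge0 => i _; nonneg.
  apply: le_trans (psi_sum x); apply: ler_sum => i _.
  apply: le_trans (phi_le _ _).
  by rewrite -[leRHS]mul1r ler_wpM2r.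
have wy x : (\int[nu]_y (w (x, y))%:E = (u x)%:E)%E.
  rewrite (eq_integral (fun y : borel T =>
      (\sum_(i <- s) (k i * phi i x) * phi i y)%:E)).
    rewrite (int_sum _ _ b)//; last by move=> i; nonneg.
    by congr EFin; apply: eq_bigr => i _; rewrite mulrAC.
  by move=> y' _; congr EFin; apply: eq_bigr => i _; rewrite mulrA.
have wx y' : (\int[mu]_x (w (x, y'))%:E = (v y')%:E)%E.
  rewrite (eq_integral (fun x : borel T =>
      (\sum_(i <- s) (k i * phi i y') * phi i x)%:E)).
    rewrite (int_sum _ _ a)//; last by move=> i; nonneg.
    by congr EFin; apply: eq_bigr => i _; rewrite mulrAC.
  by move=> x _; congr EFin; apply: eq_bigr => i _; rewrite mulrA mulrAC.
have wS z : w z != 0 -> (S `*` S) z /\ exists i, psi i z.1 != 0 /\ psi i z.2 != 0.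
  move=> wz; have [i iP] : exists i, phi i z.1 * phi i z.2 != 0.
    apply: contrapT => /forallNP h; move/eqP: wz; apply; rewrite /w big1// => i _.
    by have /negP/negPn/eqP -> := h i; rewrite mulr0.
  move: iP; rewrite mulf_eq0 negb_or /phi !mulf_eq0 !negb_or !indicE.
  move=> /andP[/andP[p1 S1] /andP[p2 S2]]; split; last by exists i.
  by split; rewrite -in_setE; [move: S1|move: S2]; case: (_ \in _); rewrite ?eqxx.
pose f := to_carrier S.
have mf : measurable_fun setT f by exact: (measurable_to_carrier dm dt mS yP).
have fE z : w z != 0 -> f z = z by move=> /wS[h _]; rewrite /f /to_carrier asboolT.
pose P : {measure set (borel T * borel T) -> \bar R} := (mu \x nu)%E.
have restrict (A : set (T * T)) :
    (\int[P]_(z in f @^-1` A) (w z)%:E =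
     \int[P]_z ((\1_A z)%:E * (w z)%:E))%E.
  rewrite integral_mkcond; apply: eq_integral => z _.
  rewrite patchE indicE; have [->|wz] := eqVneq (w z) 0.
    by rewrite mule0; case: ifP.
  rewrite (_ : (z \in f @^-1` A) = (z \in A)).
    by case: ifP; rewrite ?mul1e ?mul0e.
  by apply/idP/idP; rewrite !inE /preimage/= fE.
have intP1 (A : set (borel T)) : measurable A ->
    (\int[P]_z ((\1_A z.1)%:E * (w z)%:E) = \int[mu]_(x in A) (u x)%:E)%E.
  move=> mA; rewrite fubini_tonelli1; last 2 first.
  - apply: emeasurable_funM; last exact/measurable_EFinP.
    apply/measurable_EFinP/measurableT_comp => //; exact: measurable_indic.
  - by move=> z; rewrite mule_ge0// lee_fin.
  rewrite [RHS]integral_mkcond; apply: eq_integral => x _; rewrite /fubini_F/=.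
  rewrite ge0_integralZl_EFin//; last 2 first.
  - by move=> ? _; rewrite lee_fin.
  - by apply/measurable_EFinP; exact: (measurableT_comp mw).
  by rewrite wy patchE indicE; case: ifP; rewrite ?mul1e ?mul0e.
have intP2 (A : set (borel T)) : measurable A ->
    (\int[P]_z ((\1_A z.2)%:E * (w z)%:E) = \int[nu]_(x in A) (v x)%:E)%E.
  move=> mA.
  have mg : measurable_fun setT (fun z : borel T * borel T =>
      (\1_A z.2)%:E * (w z)%:E : \bar R)%E.
    apply: emeasurable_funM; last exact/measurable_EFinP.
    apply/measurable_EFinP/measurableT_comp => //; exact: measurable_indic.
  have g0 z : (0 <= (\1_A z.2)%:E * (w z)%:E :> \bar R)%E.
    by rewrite mule_ge0// lee_fin.
  rewrite fubini_tonelli1// fubini_tonelli//.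
  rewrite [RHS]integral_mkcond; apply: eq_integral => y' _/=.
  rewrite ge0_integralZl_EFin//; last 2 first.
  - by move=> ? _; rewrite lee_fin.
  - by apply/measurable_EFinP; exact: (measurableT_comp mw).
  by rewrite wx patchE indicE; case: ifP; rewrite ?mul1e ?mul0e.
have int_w : (\int[P]_z (w z)%:E = (\sum_(i <- s) Num.min (a i) (b i))%:E)%E.
  transitivity (\int[P]_z ((\1_setT z.1)%:E * (w z)%:E))%E.
    by apply: eq_integral => z _; rewrite indicT mul1e.
  rewrite intP1// (int_sum _ _ a)//; last by move=> i; nonneg.
  by congr EFin; apply: eq_bigr => i _; rewrite mulrAC kab.
have [|pi piE] := weighted_image_measure (m := P) mf mw w0.
  by rewrite int_w ltry.
have piT : pi setT = (\sum_(i <- s) Num.min (a i) (b i))%:E.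
  by rewrite piE// preimage_setT.
exists pi, u, v; split => //.
  move=> A mA; split.
    rewrite piE; last first.
      exact: measurable_fst_preimage.
    rewrite restrict; apply: (etrans _ (intP1 _ mA)).
    by apply: eq_integral => z _; rewrite !indicE.
  rewrite piE; last first.
    exact: measurable_snd_preimage.
  rewrite restrict; apply: (etrans _ (intP2 _ mA)).
  by apply: eq_integral => z _; rewrite !indicE.
move=> g t mg g0 t0 gt.
rewrite (ge0_integral_weighted_image mf mw w0 piE)//; last first.
  exact/measurable_EFinP.
rewrite piT -int_w -ge0_integralZl_EFin//; last 2 first.
- by move=> z _; rewrite lee_fin.
- exact/measurable_EFinP.
apply: ge0_le_integral => //.
- by move=> z _; rewrite mule_ge0 ?lee_fin.
- apply: emeasurable_funM; apply/measurable_EFinP => //.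
  exact: (measurableT_comp mg).
- by apply: emeasurable_funM => //; apply/measurable_EFinP.
move=> z _; rewrite -!EFinM lee_fin.
have [->|wz] := eqVneq (w z) 0; first by rewrite !mulr0.
rewrite ler_wpM2r// fE//; have [_ [i [p1 p2]]] := wS z wz.
by case: z {wz} p1 p2 => ? ? /=; exact: gt.
Qed.

End matched_product_coupling.

(** * The topology and the metric of the cone *)

Section product_metric.
Context (R : realType) (T : ptopologicalType) (d : T -> T -> R).
Hypotheses (dm : is_metric d) (dt : induces_topology d).

Let d2 (z w : T * T) := d z.1 w.1 + d z.2 w.2.

Lemma is_metric_sum : is_metric d2.
Proof.
case: dm => d0 ds dtr; split => [[x1 x2] [y1 y2]|z w|z w v]; rewrite /d2/=.
- split=> [|[-> ->]]; last by rewrite !(metric_xx dm) addr0.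
  move=> /eqP; rewrite paddr_eq0 ?(metric_ge0 dm)//.
  by move=> /andP[/eqP/d0 -> /eqP/d0 ->].
- by rewrite ds (ds z.2).
- by have := dtr z.1 w.1 v.1; have := dtr z.2 w.2 v.2; lra.
Qed.

Lemma induces_topology_sum : induces_topology d2.
Proof.
move=> [x y]; apply/seteqP; split=> A.
  move=> [[V W] [/= + +] VW]; rewrite !dt => -[e /= e0 eV] [f /= f0 fW].
  exists (Num.min e f) => /=; first by rewrite lt_min e0.
  move=> [u v]; rewrite /d2/= lt_min => /andP[ue vf].
  apply: VW; split => /=; [apply: eV|apply: fW] => /=.
    by apply: le_lt_trans ue; rewrite lerDl (metric_ge0 dm).
  by apply: le_lt_trans vf; rewrite lerDr (metric_ge0 dm).
move=> [e /= e0 eA]; have e20 : 0 < e / 2 by rewrite divr_gt0.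
exists ([set u | d x u < e / 2], [set v | d y v < e / 2]) => /=.
  by split; exact: (nbhs_metric dt).
by move=> [u v] [/= xu yv]; apply: eA; rewrite /d2/= [e]splitr ltrD.
Qed.

End product_metric.

Section cone_topology.
Context (R : realType) (X : ptopologicalType).
Local Notation C := (cone R X).
Local Notation radius c := (cone_radius c)%:num.

Lemma height_continuous : continuous (fun a : X * {nonneg R} => a.2%:num).
Proof.
move=> a; apply: (@continuous_comp _ _ _ snd (fun r : {nonneg R} => r%:num)).
  exact: cvg_snd.
exact: initial_continuous.
Qed.

Lemma nbhs_vertex (A : set C) : nbhs (vertex R X) A <->
  exists2 e : R, 0 < e & forall c, radius c < e -> A c.
Proof.
rewrite {1}/nbhs/= /cone_nbhs cone_radius_pt eqxx; split => -[e e0 eA];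
  by exists e.
Qed.

Lemma nbhs_cone_pt (x : X) (r : {nonneg R}) (A : set C) : 0 < r%:num ->
  nbhs (cone_pt x r) A <-> nbhs (x, r) [set a | A (cone_pt a.1 a.2)].
Proof.
by move=> r0; rewrite {1}/nbhs/= /cone_nbhs cone_radius_pt gt_eqF// cone_base_pt.
Qed.

Lemma cone_radius_eq0 (c : C) : radius c = 0 -> c = vertex R X.
Proof.
move=> c0; rewrite -(cone_ptK c); apply/cone_pt_eqP; right; split => //.
Qed.

Lemma cone_radius_continuous : continuous (fun c : C => radius c).
Proof.
move=> c A; rewrite /= => cA; have [c0|cn0] := eqVneq (radius c) 0.
  suff : nbhs (vertex R X) [set c' : C | A (radius c')].
    by rewrite -(cone_radius_eq0 c0).
  apply: (nbhs_vertex _).2.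
  move: cA; rewrite c0 => /nbhs_ballP[e /= e0 eA]; exists e => // c' ce.
  by apply: eA; rewrite /ball/= sub0r normrN ger0_norm.
have {}cn0 : 0 < radius c by rewrite lt_def cn0/=.
suff : nbhs (cone_pt (cone_base c) (cone_radius c)) [set c' : C | A (radius c')].
  by rewrite cone_ptK.
apply: (nbhs_cone_pt _ _ cn0).2.
have h : nbhs (cone_base c, cone_radius c) [set a : X * {nonneg R} | A a.2%:num].
  exact: (@height_continuous (cone_base c, cone_radius c) _ cA).
apply: filterS h => -[x r] /=.
by rewrite cone_radius_pt.
Qed.

Lemma open_cone_base (U : set X) : open U ->
  open [set c : C | 0 < radius c /\ U (cone_base c)].
Proof.
rewrite !openE => oU c /= [c0 Uc].
rewrite /interior; set B := [set _ | _].
suff : nbhs (cone_pt (cone_base c) (cone_radius c)) B by rewrite cone_ptK.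
apply: (nbhs_cone_pt _ _ c0).2; rewrite {}/B.
have h : nbhs (cone_base c, cone_radius c) [set a : X * {nonneg R} | 0 < a.2%:num].
  exact: (@height_continuous (cone_base c, cone_radius c) _ (lt_nbhsr c0)).
have hU : nbhs (cone_base c, cone_radius c) [set a : X * {nonneg R} | U a.1].
  exact: (cvg_fst (oU _ Uc)).
apply: filterS2 h hU => -[x r] /= r0 Ux.
by rewrite cone_radius_pt cone_base_pt.
Qed.

(** The base point is continuous off the vertex, and the vertex is a single
    point, so its arbitrary base point does no harm. *)
Lemma measurable_cone_base :
  measurable_fun setT (@cone_base R X : borel C -> borel X).
Proof.
have rm := continuous_measurable_real cone_radius_continuous.
apply: measurable_fun_borel => U oU.
rewrite (_ : _ @^-1` U = [set c : C | 0 < radius c /\ U (cone_base c)] `|`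
  (if `[< U (cone_base (vertex R X)) >]
   then ~` [set c : C | 0 < radius c /\ setT (cone_base c)] else set0)).
  apply: measurableU; first by apply: open_borel; exact: open_cone_base.
  case: ifPn => // _; apply: measurableC; apply: open_borel.
  by apply: open_cone_base; exact: openT.
apply/seteqP; split=> c; rewrite /preimage/=.
  move=> Uc; have [c0|cn0] := eqVneq (radius c) 0.
    right; rewrite asboolT; last by rewrite -(cone_radius_eq0 c0).
    by move=> /= []; rewrite c0 ltxx.
  by left; rewrite lt_def cn0/=.
case=> [[]//|]; case: ifPn => // /asboolP Uv /= nc.
have c0 : radius c = 0.
  by apply: contrapT => /eqP cn0; apply: nc; rewrite lt_def cn0/=.
by rewrite (cone_radius_eq0 c0).
Qed.

Definition cone_unit (x : X) : C := cone_pt x 1%:nng.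

Lemma nbhs_cone_unit (x : X) (A : set C) : nbhs (cone_unit x) A <->
  nbhs (x, 1%:nng%R : {nonneg R}) [set a | A (cone_pt a.1 a.2)].
Proof. by apply: nbhs_cone_pt; rewrite /= ltr01. Qed.

Lemma cone_unit_continuous : continuous cone_unit.
Proof.
move=> x A /= /nbhs_cone_unit [[V W] [/= xV W1] VW].
apply: filterS xV => y Vy; apply: (VW (y, 1%:nng)); split => //=.
exact: nbhs_singleton W1.
Qed.

End cone_topology.

Section cone_metric.
Context (R : realType) (X : ptopologicalType) (p : R) (hp : 1 <= p).
Local Notation C := (cone R X).
Local Notation radius c := (cone_radius c)%:num.
Variable rho : C -> C -> R.
Hypotheses (rho_metric : is_metric rho) (rho_top : induces_topology rho).
Hypothesis rho_hom : radially_homogeneous (fun c d => rho c d `^ p).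

Lemma cone_cost_scale (x1 x2 : X) (r1 r2 s1 s2 : {nonneg R}) (l : R) : 0 < l ->
  s1%:num = l * r1%:num -> s2%:num = l * r2%:num ->
  rho (cone_pt x1 s1) (cone_pt x2 s2) `^ p =
  l * rho (cone_pt x1 r1) (cone_pt x2 r2) `^ p.
Proof.
move=> l0 s1E s2E.
have -> : s1 = ((PosNum l0)%:num * r1%:num)%:nng by apply/val_inj.
have -> : s2 = ((PosNum l0)%:num * r2%:num)%:nng by apply/val_inj.
exact: rho_hom.
Qed.

Definition vertex_cost (x : X) := rho (cone_unit R x) (vertex R X) `^ p.

Lemma vertex_costE (x : X) (r : {nonneg R}) :
  rho (cone_pt x r) (vertex R X) `^ p = r%:num * vertex_cost x.
Proof.
have p0 : p != 0 by rewrite gt_eqF// (lt_le_trans ltr01).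
have [r0|rn0] := eqVneq r%:num 0.
  rewrite (_ : cone_pt x r = vertex R X); last by apply/cone_pt_eqP; right.
  by rewrite (metric_xx rho_metric) powR0// r0 mul0r.
apply: cone_cost_scale; rewrite ?mulr1 ?mulr0//.
by rewrite lt_def rn0/=.
Qed.

(** The points of radius less than 1 form a neighbourhood of the vertex, which
    therefore contains a ball; the unit section of the cone avoids it. *)
Lemma vertex_cost_lb : exists2 c : R, 0 < c & forall x, c <= vertex_cost x.
Proof.
have : nbhs (vertex R X) [set c : C | radius c < 1].
  by apply/nbhs_vertex; exists 1.
rewrite rho_top => -[e /= e0 eP]; exists (e `^ p); first exact: powR_gt0.
move=> x; rewrite /vertex_cost ge0_ler_powR ?nnegrE ?(metric_ge0 rho_metric)//.
- by rewrite (le_trans ler01).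
- exact: ltW.
rewrite leNgt; apply/negP; rewrite (metric_sym rho_metric) => /eP /=.
by rewrite cone_radius_pt/= ltxx.
Qed.

(** All points of a small enough radius [r] lie in the unit ball around the
    vertex; by homogeneity their cost is [r] times the cost at radius 1. *)
Lemma vertex_cost_ub : exists2 H : R, 0 < H & forall x, vertex_cost x <= H.
Proof.
have /nbhs_vertex[e e0 eP] := nbhs_metric rho_top (vertex R X) ltr01.
have e20 : 0 <= e / 2 by rewrite divr_ge0// ltW.
exists (2 / e); first by rewrite divr_gt0.
move=> x; have := vertex_costE x (NngNum e20).
set c := cone_pt _ _ => /= cE.
have : rho (vertex R X) c < 1 by apply: eP; rewrite cone_radius_pt/=; lra.
rewrite (metric_sym rho_metric) => /ltW c1.
have : rho c (vertex R X) `^ p <= 1.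
  have p1 : 1 `^ p = 1 :> R by rewrite powR1.
  rewrite -[leRHS]p1.
  rewrite ge0_ler_powR ?nnegrE ?(metric_ge0 rho_metric)//.
  by rewrite (le_trans ler01).
rewrite cE -ler_pdivlMl ?divr_gt0//; last by rewrite invfM invrK mulr1 mulrC.
Qed.

(** The metric of the unit section; it makes [X] metrizable. *)
Definition base_dist (x y : X) := rho (cone_unit R x) (cone_unit R y).

Lemma base_dist_metric : is_metric base_dist.
Proof.
case: rho_metric => r0 rs rt; split => [x y|x y|x y z]; rewrite /base_dist//.
split=> [/r0|->]; last exact/r0.
by move=> /cone_pt_eqP[[]//|[/=/eqP]]; rewrite oner_eq0.
Qed.

Lemma base_dist_topology : induces_topology base_dist.
Proof.
move=> x; apply/seteqP; split=> A.
  move=> /= xA; have : nbhs (cone_unit R x)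
      [set c : C | 0 < radius c /\ A° (cone_base c)].
    apply: open_nbhs_nbhs; split.
      by apply: open_cone_base; exact: open_interior.
    split; first by rewrite /cone_unit cone_radius_pt/= ltr01.
    by rewrite /cone_unit cone_base_pt/= ?ltr01.
  rewrite rho_top => -[e /= e0 eP]; exists e => // y /= /eP[_].
  by rewrite cone_base_pt/= ?ltr01//; exact: interior_subset.
move=> [e /= e0 eA].
have h : nbhs x [set y | base_dist x y < e].
  exact: (cone_unit_continuous (nbhs_metric rho_top (cone_unit R x) e0)).
by apply: filterS h => y; exact: eA.
Qed.

End cone_metric.

(** * Small transport cost forces close integrals *)

Section homogeneous_marginals.
Context (R : realType) (X : ptopologicalType).
Local Notation C := (cone R X).
Local Notation radius c := (cone_radius c)%:num.
Variables (i : C * C -> C).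
Hypothesis mi : measurable_fun setT (i : borel (C * C)%type -> borel C).
Variable alpha : {finite_measure set (borel (C * C)%type) -> \bar R}.

Lemma measurable_cone_radius :
  measurable_fun setT (fun c : borel C => radius c : R).
Proof. exact: (continuous_measurable_real (@cone_radius_continuous R X)). Qed.

(** A homogeneous marginal is the image under the projection to the base of the
    measure with density the radius, because the density vanishes at the vertex;
    integrals against it are thus integrals against the plan. *)
Lemma homogeneous_marginalP (mu : {finite_measure set (borel X) -> \bar R}) :
  homogeneous_marginal i alpha mu <->
  forall A : set (borel X), measurable A -> mu A =
    (\int[alpha]_(z in (fun z => cone_base (i z)) @^-1` A) (radius (i z))%:E)%E.
Proof.
have E (A : set (borel X)) :
    (\int[alpha]_(z in [set z | (0 < radius (i z))%R /\ A (cone_base (i z))])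
      (radius (i z))%:E =
    \int[alpha]_(z in (fun z => cone_base (i z)) @^-1` A) (radius (i z))%:E)%E.
  rewrite integral_mkcond [RHS]integral_mkcond; apply: eq_integral => z _.
  rewrite !patchE; case: ifPn => [/set_mem[r0 Az]|/negP nz].
    by rewrite mem_set.
  case: ifPn => // /set_mem Az.
  suff -> : radius (i z) = 0 by [].
  apply: contrapT => /eqP r0; apply/nz/mem_set; split => //.
  by rewrite lt_def r0/=.
by split=> h A mA; rewrite h// E.
Qed.

Lemma integral_homogeneous_marginal
    (mu : {finite_measure set (borel X) -> \bar R}) (g : borel X -> R) :
  homogeneous_marginal i alpha mu -> measurable_fun setT g ->
  (\int[mu]_x (g x)%:E =
   \int[alpha]_z (radius (i z) * g (cone_base (i z)))%:E)%E.
Proof.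
move=> /homogeneous_marginalP muE mg.
rewrite (integral_weighted_image _ _ _ muE).
- by apply: eq_integral => z _; rewrite -EFinM mulrC.
- exact: (measurableT_comp (@measurable_cone_base R X) mi).
- exact: (measurableT_comp measurable_cone_radius mi).
- by [].
- exact/measurable_EFinP.
Qed.

End homogeneous_marginals.

Lemma powRD_le (R : realType) (p a b : R) : 0 <= p -> 0 <= a -> 0 <= b ->
  (a + b) `^ p <= 2 `^ p * (a `^ p + b `^ p).
Proof.
move=> p0; wlog ab : a b / a <= b.
  move=> h a0 b0; have [ab|/ltW ba] := leP a b; first exact: h.
  by rewrite addrC [_ + b `^ p]addrC; exact: h.
move=> a0 b0; apply: (@le_trans _ _ ((2 * b) `^ p)).
  by rewrite ge0_ler_powR// ?nnegrE; lra.
by rewrite powRM// ler_wpM2l ?powR_ge0// lerDr powR_ge0.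
Qed.

Section transport_to_weak.
Context (R : realType) (X : ptopologicalType) (p : R) (hp : 1 <= p).
Local Notation C := (cone R X).
Local Notation radius c := (cone_radius c)%:num.
Variable rho : C -> C -> R.
Hypotheses (rho_metric : is_metric rho) (rho_top : induces_topology rho).
Hypothesis rho_hom : radially_homogeneous (fun c d => rho c d `^ p).

Let p0 : 0 <= p. Proof. exact: le_trans ler01 hp. Qed.

Lemma measurable_cone_cost : measurable_fun setT
  (fun z : borel (C * C)%type => rho z.1 z.2 `^ p).
Proof.
apply: (measurableT_comp (measurable_powR p)).
exact: (continuous_measurable_real (metric_continuous2 rho_metric rho_top)).
Qed.

Variables (phi : X -> R) (M : R).
Hypotheses (phi_cont : continuous phi) (phiM : forall x, `|phi x| <= M).

(* the radially 1-homogeneous extension of [phi] to the cone *)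
Let F (c : C) := radius c * phi (cone_base c).

Let M0 : 0 <= M. Proof. exact: le_trans (normr_ge0 _) (phiM point). Qed.

Let FM c : `|F c| <= M * radius c.
Proof. by rewrite /F normrM ger0_norm// mulrC ler_wpM2r. Qed.

(* base points around which [F] varies by at most [e] at distance 1/(k+1); for
   a fixed [e] these sets increase to [X] as [k] grows, by continuity of [F] *)
Let good (e : R) (k : nat) := [set x : X | forall c : C,
  rho c (cone_unit R x) < k.+1%:R^-1 -> `|F c - phi x| <= e].

Let good_measurable e k : measurable (good e k : set (borel X)).
Proof.
rewrite -[X in measurable X]setCK; apply: measurableC; apply: open_borel.
rewrite (_ : ~` _ = \bigcup_(c : C)
    ([set x | rho c (cone_unit R x) < k.+1%:R^-1] `&` [set x | e < `|F c - phi x|])).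
  apply: bigcup_open => c _; apply: openI.
    have /continuousP ce := @cone_unit_continuous R X.
    exact: (ce _ (open_metric rho_metric rho_top c _)).
  have /continuousP h : continuous (fun x => `|F c - phi x|).
    move=> x; apply: cvg_norm.
    by apply: cvgB; [exact: cvg_cst|exact: phi_cont].
  exact: (h _ (@open_gt R e)).
apply/seteqP; split=> x /=.
  move=> /existsNP[c /not_implyP[cx /negP]]; rewrite -ltNge => h.
  by exists c.
by move=> [c _ [cx h]] /(_ c cx); rewrite leNgt h.
Qed.

Let good_exhaust e (mu : {finite_measure set (borel X) -> \bar R}) (t : R) :
  0 < e -> 0 < t -> exists k, (mu (~` good e k) < t%:E)%E.
Proof.
move=> e0 t0.
have : (mu \o (fun k => ~` good e k)) n @[n --> \oo] --> mu (\bigcap_k ~` good e k).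
  apply: nonincreasing_cvg_mu.
  - by rewrite ltey_eq fin_num_measure//; exact: measurableC.
  - by move=> k; exact: measurableC.
  - by apply: bigcapT_measurable => k; exact: measurableC.
  - move=> m n mn; apply/subsetPset; apply: subsetC => x gx c cx; apply: gx.
    apply: lt_le_trans cx _.
    by rewrite lef_pV2 ?posrE// ler_nat.
rewrite (_ : \bigcap_k _ = set0) ?measure0; last first.
  rewrite -setC_bigcup; apply/seteqP; split => // x /=; apply.
  have : nbhs (cone_unit R x) [set c | `|F c - phi x| <= e].
    apply/nbhs_cone_unit.
    have phi1_cont : continuous (fun a : X * {nonneg R} => phi a.1).
      move=> a; apply: (@continuous_comp _ _ _ fst phi); first exact: cvg_fst.
      exact: phi_cont.
    have h1 : (fun a : X * {nonneg R} => a.2%:num * phi a.1) @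
        nbhs (x, 1%:nng%R : {nonneg R}) --> 1 * phi x.
      apply: cvgM; first exact: (@height_continuous R X (x, 1%:nng)).
      exact: (phi1_cont (x, 1%:nng)).
    have h2 : nbhs (x, 1%:nng%R : {nonneg R})
        [set a : X * {nonneg R} | 0 < a.2%:num].
      have r1 : 0 < (1%:nng%R : {nonneg R})%:num by rewrite /= ltr01.
      exact: (@height_continuous R X (x, 1%:nng) _ (lt_nbhsr r1)).
    move/cvgrPdist_le : h1 => /(_ _ e0); apply: filterS2 h2 => -[y s] /= s0.
    by rewrite mul1r distrC /F cone_radius_pt cone_base_pt.
  rewrite rho_top => -[r /= r0 rP]; have [k kr] := exists_natV_lt r0.
  exists k => // c cx; apply: rP => /=.
  by rewrite (metric_sym rho_metric) (lt_trans cx).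
rewrite -[X in _ --> X]/(0%:E) => /fine_cvgP[fin /cvgr_lt/(_ _ t0) small].
have [k [/= kfin ksmall]] := filter_ex (filterI fin small).
by exists k; rewrite -(fineK kfin) lte_fin.
Qed.

(* Scaling the pair so that the second radius is 1 reduces the bound to the
   slice [radius c2 = 1]. There [F] varies little near a good base point; at a
   distance at least 1/(k+1) the linear growth of [F] is dominated by the cost;
   and the bad base points only contribute to the term in [K]. *)
Let F_variation : exists2 K : R, 0 <= K & forall e k, 0 < e ->
  exists2 L : R, 0 <= L & forall c1 c2 : C,
    `|F c1 - F c2| <= radius c2 * (e + K * \1_(~` good e k) (cone_base c2)) +
      L * rho c1 c2 `^ p.
Proof.
have [c cp lb] := vertex_cost_lb hp rho_metric rho_top.
have [H H0 ub] := vertex_cost_ub hp rho_metric rho_top rho_hom.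
pose K1 := M * 2 `^ p / c; pose K2 := M * (2 `^ p * H / c + 1).
have two_p : 1 <= (2 : R) `^ p.
  by apply: le_trans (le1r_powR _ hp); rewrite ler1n.
have K10 : 0 <= K1 by rewrite divr_ge0 ?mulr_ge0 ?powR_ge0 ?(ltW cp).
have K20 : 0 <= K2.
  by rewrite mulr_ge0// addr_ge0// divr_ge0 ?(ltW cp)// mulr_ge0 ?powR_ge0 ?(ltW H0).
have radius_le (d : C) : radius d <= rho d (vertex R X) `^ p / c.
  rewrite ler_pdivlMr// -{2}(cone_ptK d) (vertex_costE hp rho_metric rho_hom).
  by rewrite ler_wpM2l.
exists K2 => // e k e0.
exists (K1 + K2 * k.+1%:R `^ p).
  by rewrite addr_ge0// mulr_ge0 ?powR_ge0.
(* the slice where the second point is [x, 1] *)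
have slice (d : C) (x : X) : `|F d - phi x| <= (e + K2 * \1_(~` good e k) x) +
    (K1 + K2 * k.+1%:R `^ p) * rho d (cone_unit R x) `^ p.
  set q := rho _ _ `^ p.
  have q0 : 0 <= q by exact: powR_ge0.
  have crude : `|F d - phi x| <= K1 * q + K2.
    apply: le_trans (ler_normB _ _) _.
    apply: le_trans (lerD (FM d) (phiM x)) _.
    have : radius d <= 2 `^ p * (q + H) / c.
      apply: le_trans (radius_le d) _; rewrite ler_wpM2r ?invr_ge0 ?(ltW cp)//.
      apply: (@le_trans _ _ ((rho d (cone_unit R x) +
          rho (cone_unit R x) (vertex R X)) `^ p)).
        by rewrite ge0_ler_powR// ?nnegrE ?addr_ge0 ?(metric_ge0 rho_metric)//
          (metric_triangle rho_metric).
      apply: le_trans (powRD_le p0 _ _) _; rewrite ?(metric_ge0 rho_metric)//.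
      by rewrite ler_wpM2l ?powR_ge0// lerD2l; exact: ub.
    move=> /(ler_wpM2l M0) h.
    apply: le_trans (lerD h (lexx M)) _.
    by rewrite le_eqVlt; apply/orP; left; apply/eqP; rewrite /K1 /K2; ring.
  have mid0 : 0 <= K2 * k.+1%:R `^ p * q.
    by apply: mulr_ge0 => //; apply: mulr_ge0 => //; exact: powR_ge0.
  have K1q : 0 <= K1 * q by exact: mulr_ge0.
  rewrite indicE; case: (boolP (x \in ~` good e k)) => [_|].
    rewrite mulr1 mulrDl; apply: le_trans crude _; lra.
  rewrite mulr0 addr0 notin_setE => /contrapT gx.
  have [near|far] := ltP (rho d (cone_unit R x)) k.+1%:R^-1.
    by apply: le_trans (gx _ near) _; rewrite mulrDl; lra.
  apply: le_trans crude _.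
  have : 1 <= k.+1%:R `^ p * q.
    rewrite /q -powRM ?(metric_ge0 rho_metric)//.
    have p1 : 1 `^ p = 1 :> R by rewrite powR1.
    rewrite -[leLHS]p1 ge0_ler_powR// ?nnegrE ?mulr_ge0 ?(metric_ge0 rho_metric)//.
    by rewrite -ler_pdivrMl// mulr1.
  move=> /(ler_wpM2l K20); rewrite mulr1 mulrA => h.
  by rewrite mulrDl; lra.
move=> c1 c2; have [r20|r2n0] := eqVneq (radius c2) 0.
  have c2E := cone_radius_eq0 r20.
  rewrite r20 mul0r add0r /F r20 mul0r subr0 c2E.
  apply: le_trans (FM c1) _.
  apply: (@le_trans _ _ (M * (rho c1 (vertex R X) `^ p / c))).
    by rewrite ler_wpM2l.
  rewrite mulrDl -[leLHS]addr0 lerD//; last first.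
    by apply: mulr_ge0; [apply: mulr_ge0 => //|]; exact: powR_ge0.
  rewrite mulrA mulrAC ler_wpM2r ?powR_ge0// /K1 ler_wpM2r ?invr_ge0 ?(ltW cp)//.
  by rewrite ler_peMr.
have r2 : 0 < radius c2 by rewrite lt_def r2n0/=.
have s0 : 0 <= radius c1 / radius c2 by rewrite divr_ge0.
pose d := cone_pt (cone_base c1) (NngNum s0).
have Fd : F c1 = radius c2 * F d.
  rewrite /F /d cone_radius_pt/= mulrA mulrCA divff// mulr1.
  have [r10|r1n0] := eqVneq (radius c1) 0.
    have z (a : R) : radius c1 * a = 0 by rewrite r10 mul0r.
    by rewrite !z.
  by rewrite cone_base_pt//= divr_gt0// lt_def r1n0/=.
have cost : rho c1 c2 `^ p =
    radius c2 * rho d (cone_unit R (cone_base c2)) `^ p.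
  rewrite -{1}(cone_ptK c1) -{1}(cone_ptK c2).
  apply: (cone_cost_scale rho_hom) => //=; last by rewrite mulr1.
  by rewrite mulrCA divff// mulr1.
rewrite Fd cost {2}/F -mulrBr normrM ger0_norm// mulrCA -mulrDr ler_wpM2l//.
Qed.

(** The difference of the integrals of [phi] is the integral over the plan of
    the variation of its 1-homogeneous extension. Integrating the pointwise bound
    leaves the cost and a term that only depends on the fixed measure [mu], which
    is small once the bad base points have a small [mu]-measure; this is why the
    constant [L] is uniform in [nu] and in the plan. *)
Lemma homogeneous_plans_integral_close
    (mu : {finite_measure set (borel X) -> \bar R}) (t : R) : 0 < t ->
  exists2 L : R, 0 <= L & forall nu alpha,
    homogeneous_plans nu mu alpha ->
    (`|\int[nu]_x (phi x)%:E - \int[mu]_x (phi x)%:E| <=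
      t%:E + L%:E * \int[alpha]_z (rho z.1 z.2 `^ p)%:E)%E.
Proof.
move=> t0; have [K K0 KP] := F_variation.
have mfin : mu setT \is a fin_num by rewrite fin_num_measure.
pose m := fine (mu setT); have m0 : 0 <= m by exact: fine_ge0.
pose e := t / (2 * (m + 1)).
have e0 : 0 < e by rewrite divr_gt0// mulr_gt0// ltr_wpDl.
pose t' := t / (2 * (K + 1)).
have t'0 : 0 < t' by rewrite divr_gt0// mulr_gt0// ltr_wpDl.
have [k kt] := good_exhaust mu e0 t'0.
have [L L0 LP] := KP e k e0.
exists L => // nu alpha [_ rfin nuE muE].
have mfst : measurable_fun setT (fst : borel (C * C)%type -> borel C).
  exact: measurable_borel_fst.
have msnd : measurable_fun setT (snd : borel (C * C)%type -> borel C).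
  exact: measurable_borel_snd.
have mphi : measurable_fun setT (phi : borel X -> R).
  exact: continuous_measurable_real.
have mr := @measurable_cone_radius R X.
have mF : measurable_fun setT (F : borel C -> R).
  apply: measurable_funM => //.
  exact: (measurableT_comp mphi (@measurable_cone_base R X)).
have mF1 := measurableT_comp mF mfst; have mF2 := measurableT_comp mF msnd.
have intF i : (i = fst \/ i = snd) ->
    measurable_fun setT (fun z : borel (C * C)%type => F (i z)) ->
    alpha.-integrable setT (fun z => (F (i z))%:E).
  move=> iE mFi; apply/integrableP; split; first exact/measurable_EFinP.
  apply: (@le_lt_trans _ _ (M%:E *
      \int[alpha]_z (radius z.1 + radius z.2)%:E)%E); last first.
    apply: lte_mul_pinfty => //.
  rewrite -ge0_integralZl_EFin//; last first.
    by apply/measurable_EFinP; apply: measurable_funD;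
      [exact: (measurableT_comp mr mfst)|exact: (measurableT_comp mr msnd)].
  apply: ge0_le_integral => //.
  - by apply/measurable_EFinP; exact: measurableT_comp.
  - by apply/measurable_EFinP; apply: measurable_funM => //; apply: measurable_funD;
      [exact: (measurableT_comp mr mfst)|exact: (measurableT_comp mr msnd)].
  move=> z _; rewrite -EFinM lee_fin; apply: le_trans (FM _) _.
  by rewrite ler_wpM2l//; case: iE => ->; rewrite ?lerDl ?lerDr.
rewrite (integral_homogeneous_marginal mfst nuE)//.
rewrite (integral_homogeneous_marginal msnd muE)//.
rewrite -integralB//; last 2 first.
- exact: intF (or_introl erefl) mF1.
- exact: intF (or_intror erefl) mF2.
apply: le_trans (le_abse_integral _ _ _) _ => //.
  by apply: emeasurable_funB; exact/measurable_EFinP.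
have mbad : measurable_fun setT
    (fun x : borel X => e + K * \1_(~` good e k) x : R).
  apply: measurable_funD => //; apply: measurable_funM => //.
  by apply: measurable_indic; exact: measurableC.
have mc := measurable_cone_cost.
have mrb : measurable_fun setT (fun z : borel (C * C)%type =>
    radius z.2 * (e + K * \1_(~` good e k) (cone_base z.2)) : R).
  apply: measurable_funM; first exact: (measurableT_comp mr msnd).
  exact: (measurableT_comp mbad (measurableT_comp (@measurable_cone_base R X) msnd)).
have bad0 x : 0 <= e + K * \1_(~` good e k) x :> R.
  by rewrite addr_ge0 ?(ltW e0)// mulr_ge0.
apply: (@le_trans _ _ (\int[alpha]_z
    ((radius z.2 * (e + K * \1_(~` good e k) (cone_base z.2)))%:E +
     (L * rho z.1 z.2 `^ p)%:E))%E).
  apply: ge0_le_integral => //.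
  - apply/measurable_EFinP; apply: measurableT_comp => //.
    exact: measurable_funB.
  - apply/measurable_EFinP; apply: measurable_funD => //.
    exact: measurable_funM.
  - by move=> z _; rewrite -EFinD lee_fin; exact: LP.
rewrite ge0_integralD//; last 4 first.
- by move=> z _; rewrite lee_fin mulr_ge0.
- exact/measurable_EFinP.
- by move=> z _; rewrite lee_fin mulr_ge0// powR_ge0.
- by apply/measurable_EFinP; exact: measurable_funM.
apply: leeD; last first.
  under eq_integral do rewrite EFinM.
  rewrite ge0_integralZl_EFin//.
  - by move=> z _; rewrite lee_fin powR_ge0.
  - exact/measurable_EFinP.
rewrite -(integral_homogeneous_marginal msnd muE mbad).
under eq_integral do rewrite EFinD.
rewrite ge0_integralD//; last 3 first.
- by move=> x _; rewrite lee_fin ltW.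
- by move=> x _; rewrite lee_fin mulr_ge0.
- apply/measurable_EFinP; apply: measurable_funM => //.
  by apply: measurable_indic; exact: measurableC.
rewrite integral_cst//.
under eq_integral do rewrite EFinM.
rewrite ge0_integralZl_EFin//; last first.
  by apply/measurable_EFinP; apply: measurable_indic; exact: measurableC.
rewrite integral_indic ?setIT//; last exact: measurableC.
apply: (@le_trans _ _ ((e * m)%:E + K%:E * t'%:E)%E).
  have muTE : (e * m)%:E = (e%:E * mu setT)%E by rewrite EFinM (fineK mfin).
  apply: leeD; first by rewrite muTE.
  by rewrite lee_wpmul2l ?lee_fin// ltW.
rewrite -EFinM -EFinD lee_fin /e /t'.
have h1 : t / (2 * (m + 1)) * m <= t / 2.
  rewrite mulrAC ler_pdivrMr ?mulr_gt0 ?ltr_wpDl//.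
  rewrite (_ : t / 2 * _ = t * (m + 1)); last by field.
  by rewrite ler_wpM2l ?(ltW t0)// lerDl.
have h2 : K * (t / (2 * (K + 1))) <= t / 2.
  rewrite mulrA ler_pdivrMr ?mulr_gt0 ?ltr_wpDl//.
  rewrite (_ : t / 2 * _ = (K + 1) * t); last by field.
  by rewrite ler_wpM2r ?(ltW t0)// lerDl.
lra.
Qed.

End transport_to_weak.

(** * From a partial coupling to a transport plan *)

Section partial_coupling_plan.
Context (R : realType) (X : ptopologicalType) (p : R).
Local Notation C := (cone R X).
Local Notation radius c := (cone_radius c)%:num.
Variable rho : C -> C -> R.
Hypotheses (rho_metric : is_metric rho) (rho_top : induces_topology rho).
Hypothesis hX : hausdorff_space X.

Variables (mu nu : {finite_measure set (borel X) -> \bar R}).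
Hypotheses (rmu : radon mu) (rnu : radon nu).
Variables (pi : {finite_measure set (borel (X * X)%type) -> \bar R}).
Variables (u v : X -> R).
Hypotheses (meas_u : measurable_fun setT (u : borel X -> R))
  (u01 : forall x, 0 <= u x <= 1).
Hypotheses (meas_v : measurable_fun setT (v : borel X -> R))
  (v01 : forall x, 0 <= v x <= 1).
Hypothesis pi1 : forall A : set (borel X), measurable A ->
  (pi (fst @^-1` A) = \int[mu]_(x in A) (u x)%:E)%E.
Hypothesis pi2 : forall A : set (borel X), measurable A ->
  (pi (snd @^-1` A) = \int[nu]_(x in A) (v x)%:E)%E.

Let unit2 (z : X * X) : C * C := (cone_unit R z.1, cone_unit R z.2).
Let inl (x : X) : C * C := (cone_unit R x, vertex R X).
Let inr (x : X) : C * C := (vertex R X, cone_unit R x).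

Let unit2_cont : continuous unit2.
Proof.
have c1 : continuous (fun z : X * X => cone_unit R z.1).
  move=> z; apply: (@continuous_comp _ _ _ fst (@cone_unit R X)).
    exact: cvg_fst.
  exact: cone_unit_continuous.
have c2 : continuous (fun z : X * X => cone_unit R z.2).
  move=> z; apply: (@continuous_comp _ _ _ snd (@cone_unit R X)).
    exact: cvg_snd.
  exact: cone_unit_continuous.
by move=> z; exact: (cvg_pair (c1 z) (c2 z)).
Qed.

Let inl_cont : continuous inl.
Proof.
move=> x; exact: (cvg_pair (@cone_unit_continuous R X x) (cvg_cst (vertex R X))).
Qed.

Let inr_cont : continuous inr.
Proof.
move=> x; exact: (cvg_pair (cvg_cst (vertex R X)) (@cone_unit_continuous R X x)).
Qed.

Let munit2 : measurable_fun setT (unit2 : borel (X * X)%type -> borel (C * C)%type).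
Proof. exact: continuous_measurable_borel. Qed.
Let minl : measurable_fun setT (inl : borel X -> borel (C * C)%type).
Proof. exact: continuous_measurable_borel. Qed.
Let minr : measurable_fun setT (inr : borel X -> borel (C * C)%type).
Proof. exact: continuous_measurable_borel. Qed.

Let meas_u1 : measurable_fun setT (fun x : borel X => 1 - u x).
Proof. exact: measurable_funB. Qed.
Let meas_v1 : measurable_fun setT (fun x : borel X => 1 - v x).
Proof. exact: measurable_funB. Qed.
Let u1_ge0 x : 0 <= 1 - u x.
Proof. by rewrite subr_ge0; case/andP: (u01 x). Qed.
Let v1_ge0 x : 0 <= 1 - v x.
Proof. by rewrite subr_ge0; case/andP: (v01 x). Qed.

Let int_compl (m : {finite_measure set (borel X) -> \bar R}) (w : X -> R)
    (A : set (borel X)) :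
  measurable_fun setT (w : borel X -> R) -> (forall x, 0 <= w x <= 1) ->
  measurable A ->
  (\int[m]_(x in A) (w x)%:E + \int[m]_(x in A) (1 - w x)%:E = m A)%E.
Proof.
move=> mw w01 mA.
have w0 x : 0 <= w x by case/andP: (w01 x).
have w1 x : 0 <= 1 - w x by rewrite subr_ge0; case/andP: (w01 x).
rewrite -ge0_integralD//.
- rewrite (eq_integral (cst 1%E)); first by rewrite integral_cst// mul1e.
  by move=> x _; rewrite -EFinD addrC subrK.
- by move=> x _; rewrite lee_fin.
- by apply/measurable_EFinP; exact: measurable_funTS.
- by move=> x _; rewrite lee_fin.
- by apply/measurable_EFinP; apply: measurable_funTS; exact: measurable_funB.
Qed.

Let fin (m : {finite_measure set (borel X) -> \bar R}) : (m setT < +oo)%E.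
Proof. by rewrite ltey_eq fin_num_measure. Qed.

(* The plan moves mass at radius 1 according to [pi]; what [pi] leaves over of
   [mu] is shrunk to the vertex, and what it leaves over of [nu] grows from it. *)
Let plan_exists : exists alpha : {finite_measure set (borel (C * C)%type) -> \bar R},
  forall g : C * C -> R, measurable_fun setT (g : borel (C * C)%type -> R) ->
    (forall z, 0 <= g z) ->
    (\int[alpha]_z (g z)%:E =
      \int[pi]_z (g (unit2 z))%:E + \int[mu]_x (g (inl x) * (1 - u x))%:E +
      \int[nu]_x (g (inr x) * (1 - v x))%:E)%E.
Proof.
have [|a1 a1E] := weighted_image_measure (m := pi) munit2
    (@measurable_cst _ _ _ _ setT (1 : R)) (fun=> ler01).
  rewrite -[X in (X < _)%E]/(\int[pi]_(x in setT) cst 1%E x)%E.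
  by rewrite integral_cst//= mul1e ltey_eq fin_num_measure.
have [|a2 a2E] := weighted_image_measure (m := mu) minl meas_u1 u1_ge0.
  apply: le_lt_trans (fin mu); rewrite -(int_compl mu meas_u u01 measurableT).
  rewrite leeDr// integral_ge0// => x _; rewrite lee_fin.
  by case/andP: (u01 x).
have [|a3 a3E] := weighted_image_measure (m := nu) minr meas_v1 v1_ge0.
  apply: le_lt_trans (fin nu); rewrite -(int_compl nu meas_v v01 measurableT).
  rewrite leeDr// integral_ge0// => x _; rewrite lee_fin.
  by case/andP: (v01 x).
pose a12 : {measure set (borel (C * C)%type) -> \bar R} := measure_add a1 a2.
pose b : {measure set (borel (C * C)%type) -> \bar R} := measure_add a12 a3.
have bE A : b A = (a1 A + a2 A + a3 A)%E.
  by rewrite [LHS](measure_addE a12) [X in (X + _)%E](measure_addE a1).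
have [|a aE] := finite_measure_of (m := b).
  rewrite bE; apply: lte_add_pinfty; first apply: lte_add_pinfty;
    by rewrite ltey_eq fin_num_measure.
exists a => g mg g0.
have mgE : measurable_fun setT (fun z : borel (C * C)%type => (g z)%:E).
  exact/measurable_EFinP.
rewrite (eq_measure_integral b); last by move=> A _ _; exact: aE.
rewrite [LHS](ge0_integral_measure_add a12 a3)//; last first.
  by move=> z _; rewrite lee_fin.
rewrite [X in (X + _)%E](ge0_integral_measure_add a1 a2)//; last first.
  by move=> z _; rewrite lee_fin.
congr (_ + _ + _)%E.
- rewrite (ge0_integral_weighted_image munit2 _ _ a1E)//.
  by apply: eq_integral => z _; rewrite mule1.
- by rewrite (ge0_integral_weighted_image minl _ _ a2E).
- by rewrite (ge0_integral_weighted_image minr _ _ a3E).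
Qed.

Variables (H : R) (H0 : 0 <= H) (HP : forall x, vertex_cost p rho x <= H).

Let slice_radius (x : X) : (cone_radius (cone_unit R x))%:num = 1 :> R.
Proof. by rewrite cone_radius_pt. Qed.
Let slice_base (x : X) : cone_base (cone_unit R x) = x.
Proof. by rewrite cone_base_pt//= ltr01. Qed.
Let vertex_radius : (cone_radius (vertex R X))%:num = 0 :> R.
Proof. by rewrite cone_radius_pt. Qed.

(** The vertex serves as a reservoir that makes up for masses that do not match,
    at a cost of at most [H] per unit of mass. Away from the vertex
    the marginals of the plan are the images of [mu] and [nu] in the unit section,
    so that the plan is as tight as [mu] and [nu] are, hence Radon. *)
Lemma partial_coupling_plan :
  exists2 alpha, homogeneous_plans mu nu alpha &
    (\int[alpha]_z (rho z.1 z.2 `^ p)%:E <=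
      \int[pi]_z (base_dist rho z.1 z.2 `^ p)%:E +
      H%:E * (mu setT - pi setT) + H%:E * (nu setT - pi setT))%E.
Proof.
have [alpha alphaE] := plan_exists.
have mfst : measurable_fun setT (fst : borel (C * C)%type -> borel C).
  exact: measurable_borel_fst.
have msnd : measurable_fun setT (snd : borel (C * C)%type -> borel C).
  exact: measurable_borel_snd.
have mr := @measurable_cone_radius R X.
have mb := @measurable_cone_base R X.
pose w (A : set X) (c : C) : R := radius c * \1_A (cone_base c).
have mw A : measurable (A : set (borel X)) -> measurable_fun setT (w A : borel C -> R).
  move=> mA; apply: measurable_funM => //.
  have mi : measurable_fun setT (\1_A : borel X -> R) by exact: measurable_indic.
  exact: (measurableT_comp mi mb).
have w0 A c : 0 <= w A c by rewrite mulr_ge0.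
have w_unit A x : w A (cone_unit R x) = \1_A x.
  by rewrite /w slice_radius slice_base mul1r.
have w_vertex A : w A (vertex R X) = 0 by rewrite /w vertex_radius mul0r.
have part1 A : measurable (A : set (borel X)) ->
    (\int[alpha]_z (w A z.1)%:E = mu A)%E.
  move=> mA; rewrite (alphaE (fun z => w A z.1))//; last first.
    exact: (measurableT_comp (mw A mA) mfst).
  under eq_integral do rewrite w_unit.
  under [X in (_ + X + _)%E]eq_integral do rewrite w_unit.
  under [X in (_ + _ + X)%E]eq_integral do rewrite w_vertex mul0r.
  rewrite integral0 adde0 -(int_compl mu meas_u u01 mA) -pi1//; congr (_ + _)%E.
    rewrite -[in RHS](setIT (fst @^-1` A)) -integral_indic//.
    exact: measurable_fst_preimage.
  rewrite [RHS]integral_mkcond; apply: eq_integral => x _.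
  by rewrite patchE indicE; case: ifP; rewrite ?mul1r ?mul0r.
have part2 A : measurable (A : set (borel X)) ->
    (\int[alpha]_z (w A z.2)%:E = nu A)%E.
  move=> mA; rewrite (alphaE (fun z => w A z.2))//; last first.
    exact: (measurableT_comp (mw A mA) msnd).
  under eq_integral do rewrite w_unit.
  under [X in (_ + X + _)%E]eq_integral do rewrite w_vertex mul0r.
  under [X in (_ + _ + X)%E]eq_integral do rewrite w_unit.
  rewrite integral0 adde0 -(int_compl nu meas_v v01 mA) -pi2//; congr (_ + _)%E.
    rewrite -[in RHS](setIT (snd @^-1` A)) -integral_indic//.
    exact: measurable_snd_preimage.
  rewrite [RHS]integral_mkcond; apply: eq_integral => x _.
  by rewrite patchE indicE; case: ifP; rewrite ?mul1r ?mul0r.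
have marg i (m : {finite_measure set (borel X) -> \bar R}) :
    (forall A, measurable (A : set (borel X)) ->
      (\int[alpha]_z (w A (i z))%:E = m A)%E) ->
    homogeneous_marginal i alpha m.
  move=> mE; apply/homogeneous_marginalP => A mA.
  rewrite -mE// [RHS]integral_mkcond; apply: eq_integral => z _.
  rewrite patchE /w indicE (_ : (z \in _) = (cone_base (i z) \in A)).
    by case: ifP; rewrite ?mulr1 ?mulr0.
  by apply/idP/idP; rewrite !inE.
have mono (g1 g2 : C * C -> R) :
    measurable_fun setT (g1 : borel (C * C)%type -> R) ->
    measurable_fun setT (g2 : borel (C * C)%type -> R) ->
    (forall z, 0 <= g1 z) -> (forall z, 0 <= g2 z) ->
    (forall z, g1 (unit2 z) <= g2 (unit2 z)) ->
    (forall x, g1 (inl x) <= g2 (inl x)) -> (forall x, g1 (inr x) <= g2 (inr x)) ->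
    (\int[alpha]_z (g1 z)%:E <= \int[alpha]_z (g2 z)%:E)%E.
  move=> mg1 mg2 g10 g20 le1 le2 le3; rewrite !alphaE//.
  have mcomp (g : C * C -> R) d (Y : measurableType d) (f : Y -> borel (C * C)%type) :
      measurable_fun setT (g : borel (C * C)%type -> R) ->
      measurable_fun setT f -> measurable_fun setT (fun y => (g (f y))%:E).
    by move=> mg mf; apply/measurable_EFinP; exact: (measurableT_comp mg mf).
  apply: leeD; first apply: leeD; apply: ge0_le_integral => //;
    try by [move=> y _; rewrite lee_fin ?mulr_ge0 ?ler_wpM2r | exact: mcomp
      | apply/measurable_EFinP; apply: measurable_funM => //;
        apply/measurable_EFinP; exact: mcomp].
have tight1 (K : set X) : compact K -> exists K' : set C,
    [/\ compact K', measurable (K' : set (borel C)),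
        K' (vertex R X) & forall x, ~ K' (cone_unit R x) -> ~ K x].
  move=> cK; exists ([set cone_unit R x | x in K] `|` [set vertex R X]).
  have cK' : compact ([set cone_unit R x | x in K] `|` [set vertex R X]).
    apply: compactU; last exact: compact_set1.
    apply: continuous_compact => //; apply: continuous_subspaceT.
    exact: cone_unit_continuous.
  split => //.
  - apply: closed_borel; apply: compact_closed cK'.
    exact: metric_hausdorff rho_metric rho_top.
  - by right.
  - by move=> x nK' Kx; apply: nK'; left; exists x.
exists alpha.
  split.
  - apply: (tight_radon (is_metric_sum rho_metric)
      (induces_topology_sum rho_metric rho_top)) => e e0.
    have e20 : 0 < e / 2 by rewrite divr_gt0.
    have [K1 [cK1 _ h1]] := rmu measurableT e20.
    have [K2 [cK2 _ h2]] := rnu measurableT e20.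
    rewrite !setTD in h1 h2.
    have mK (K : set X) : compact K -> measurable (~` K : set (borel X)).
      by move=> cK; apply: measurableC; apply: closed_borel; exact: compact_closed.
    have [L1 [cL1 mL1 vL1 L1P]] := tight1 _ cK1.
    have [L2 [cL2 mL2 vL2 L2P]] := tight1 _ cK2.
    exists (L1 `*` L2); split; first exact: compact_setX.
    have mN1 : measurable (fst @^-1` (~` L1) : set (borel (C * C)%type)).
      by apply: measurable_fst_preimage; exact: measurableC.
    have mN2 : measurable (snd @^-1` (~` L2) : set (borel (C * C)%type)).
      by apply: measurable_snd_preimage; exact: measurableC.
    have mN : measurable (~` (L1 `*` L2) : set (borel (C * C)%type)).
      rewrite (_ : ~` _ = fst @^-1` (~` L1) `|` snd @^-1` (~` L2)).
        exact: measurableU.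
      apply/seteqP; split=> z; last by move=> [h [/h]|h [_ /h]].
      by move=> /not_andP[h|h]; [left|right].
    rewrite [e]splitr EFinD; apply: le_lt_trans (lteD h1 h2).
    rewrite -part1; last exact: mK.
    rewrite -part2; last exact: mK.
    rewrite -[in leLHS](setIT (~` (L1 `*` L2))) -integral_indic//.
    rewrite -ge0_integralD//; last 4 first.
    + by move=> z _; rewrite lee_fin.
    + by apply/measurable_EFinP; apply: (measurableT_comp (mw _ _) mfst); exact: mK.
    + by move=> z _; rewrite lee_fin.
    + by apply/measurable_EFinP; apply: (measurableT_comp (mw _ _) msnd); exact: mK.
    under [leRHS]eq_integral do rewrite -EFinD.
    apply: (mono _ (fun z => w (~` K1) z.1 + w (~` K2) z.2)).
    + exact: measurable_indic.
    + apply: measurable_funD.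
        by apply: (measurableT_comp (mw _ _) mfst); exact: mK.
      by apply: (measurableT_comp (mw _ _) msnd); exact: mK.
    + by move=> z.
    + by move=> z; rewrite addr_ge0.
    + move=> [x y]; rewrite /unit2/= !w_unit indicE.
      case: (boolP (_ \in _)) => [/set_mem /not_andP[/= h|/= h]|_].
      * by rewrite [X in X + _]indicE mem_set ?lerDl//; exact: L1P h.
      * by rewrite [X in _ + X]indicE mem_set ?lerDr//; exact: L2P h.
      * by rewrite addr_ge0.
    + move=> x; rewrite /inl/= w_unit w_vertex addr0 indicE.
      case: (boolP (_ \in _)) => [/set_mem /not_andP[/= h|/= /(_ vL2)//]|_] //.
      by rewrite indicE mem_set//; exact: L1P h.
    + move=> x; rewrite /inr/= w_unit w_vertex add0r indicE.
      case: (boolP (_ \in _)) => [/set_mem /not_andP[/= /(_ vL1)//|/= h]|_] //.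
      by rewrite indicE mem_set//; exact: L2P h.
  - rewrite (_ : \int[alpha]_z _ = mu setT + nu setT)%E.
      exact: lte_add_pinfty.
    rewrite -part1// -part2// -ge0_integralD//.
    + by apply: eq_integral => z _; rewrite /w !indicT !mulr1 EFinD.
    + by move=> z _; rewrite lee_fin.
    + by apply/measurable_EFinP; exact: (measurableT_comp (mw _ measurableT) mfst).
    + by move=> z _; rewrite lee_fin.
    + by apply/measurable_EFinP; exact: (measurableT_comp (mw _ measurableT) msnd).
  - exact: marg part1.
  - exact: marg part2.
have mcost := measurable_cone_cost p rho_metric rho_top.
have leftover (m : {finite_measure set (borel X) -> \bar R}) (t : X -> R)
    (g : X -> R) : measurable_fun setT (t : borel X -> R) ->
    (forall x, 0 <= t x <= 1) -> measurable_fun setT (g : borel X -> R) ->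
    (forall x, 0 <= g x <= H) -> (\int[m]_x (t x)%:E = pi setT)%E ->
    (\int[m]_x (g x * (1 - t x))%:E <= H%:E * (m setT - pi setT))%E.
  move=> mt t01 mg gH tE.
  have t1 x : 0 <= 1 - t x by rewrite subr_ge0; case/andP: (t01 x).
  have mt1 : measurable_fun setT (fun x : borel X => 1 - t x) by exact: measurable_funB.
  rewrite -(int_compl m mt t01 measurableT) tE.
  rewrite addeC addeK; last by rewrite fin_num_measure.
  rewrite -ge0_integralZl_EFin//; last 2 first.
  - by move=> x _; rewrite lee_fin.
  - exact/measurable_EFinP.
  apply: ge0_le_integral => //.
  - by move=> x _; rewrite lee_fin mulr_ge0//; case/andP: (gH x).
  - by apply/measurable_EFinP; exact: measurable_funM.
  - by apply/measurable_EFinP; exact: measurable_funM.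
  - by move=> x _; rewrite -EFinM lee_fin ler_wpM2r//; case/andP: (gH x).
rewrite (alphaE (fun z => rho z.1 z.2 `^ p))//; last by move=> z; exact: powR_ge0.
apply: leeD; first apply: leeD => //.
- apply: leftover => //.
  + exact: (measurableT_comp mcost minl).
  + by move=> x; rewrite powR_ge0; exact: HP.
  + by rewrite -pi1// preimage_setT.
- apply: leftover => //.
  + exact: (measurableT_comp mcost minr).
  + by move=> x; rewrite powR_ge0 (metric_sym rho_metric); exact: HP.
  + by rewrite -pi2// preimage_setT.
Qed.

End partial_coupling_plan.

(** * Partitions of unity *)

Section partition.
Context (R : realType) (T : ptopologicalType) (d : T -> T -> R).
Hypotheses (dm : is_metric d) (dt : induces_topology d).
Variables (s : seq T) (e : R).
Hypothesis e0 : 0 < e.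

Definition hat (y x : T) : R := Num.max 0 (2 * e - d y x).

(** Dividing by the maximum with [e] keeps the quotient continuous everywhere,
    and the sum is still 1 at distance less than [e] from the centres [s]. *)
Definition partition_fun (y x : T) : R :=
  hat y x / Num.max (\sum_(z <- s) hat z x) e.

Let hat0 y x : 0 <= hat y x. Proof. by rewrite /hat le_max lexx. Qed.

Let denom0 x : 0 < Num.max (\sum_(z <- s) hat z x) e.
Proof. by rewrite lt_max e0 orbT. Qed.

Lemma partition_fun_ge0 y x : 0 <= partition_fun y x.
Proof. by rewrite divr_ge0// ltW. Qed.

Lemma partition_fun_le2 y x : partition_fun y x <= 2.
Proof.
rewrite ler_pdivrMr// ge_max; apply/andP; split.
  by rewrite mulr_ge0// ltW.
apply: (@le_trans _ _ (2 * e)); first by rewrite gerBl (metric_ge0 dm).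
by rewrite ler_wpM2l// le_max lexx orbT.
Qed.

Lemma partition_fun_neq0 y x : partition_fun y x != 0 -> d y x < 2 * e.
Proof.
rewrite ltNge; apply: contra => h.
by rewrite /partition_fun /hat max_l ?mul0r// subr_le0.
Qed.

Lemma partition_fun_sum_le1 x : \sum_(y <- s) partition_fun y x <= 1.
Proof.
by rewrite -mulr_suml ler_pdivrMr// mul1r le_max lexx.
Qed.

Lemma partition_fun_sum_eq1 x : (exists2 y, y \in s & d y x < e) ->
  \sum_(y <- s) partition_fun y x = 1.
Proof.
move=> [y ys yx]; rewrite -mulr_suml max_l ?divff//.
  rewrite gt_eqF//; apply: (lt_le_trans e0).
  rewrite (big_rem y)//= -[leLHS]addr0 lerD ?sumr_ge0//.
  by rewrite /hat le_max; apply/orP; right; lra.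
rewrite (big_rem y)//= -[leLHS]addr0 lerD ?sumr_ge0//.
by rewrite /hat le_max; apply/orP; right; lra.
Qed.

Lemma partition_fun_continuous y : continuous (partition_fun y).
Proof.
have hat_cont z : continuous (hat z).
  move=> x; apply: (@continuous_max R T (cst 0) (fun x => 2 * e - d z x) x).
    exact: cvg_cst.
  by apply: cvgB; [exact: cvg_cst|exact: (metric_continuousr dm dt)].
have sum_cont : continuous (fun x => \sum_(z <- s) hat z x).
  apply: continuous_big; last by move=> z _; exact: hat_cont.
  exact: add_continuous.
move=> x; apply: cvgM; first exact: hat_cont.
apply: cvgV; first by rewrite gt_eqF.
apply: (@continuous_max R T (fun x => \sum_(z <- s) hat z x) (cst e) x).
  exact: sum_cont.
exact: cvg_cst.
Qed.

End partition.

(** * Upper bounds for the transport distance *)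

Section transport_bounds.
Context (R : realType) (X : ptopologicalType) (hX : hausdorff_space X).
Context (p : R) (hp : 1 <= p).
Local Notation C := (cone R X).
Variable rho : C -> C -> R.
Hypotheses (rho_metric : is_metric rho) (rho_top : induces_topology rho).
Hypothesis rho_hom : radially_homogeneous (fun c d => rho c d `^ p).

Let p_gt0 : 0 < p. Proof. exact: lt_le_trans ltr01 hp. Qed.
Let d := base_dist rho.
Let dm : is_metric d := base_dist_metric rho_metric.
Let dt : induces_topology d := base_dist_topology rho_top.

Lemma cone_transport_dist_ge0 mu nu : (0 <= cone_transport_dist rho p mu nu)%E.
Proof. exact: poweR_ge0. Qed.

Lemma cone_transport_dist_lt mu nu alpha (e : R) : 0 < e ->
  homogeneous_plans mu nu alpha ->
  (\int[alpha]_z (rho z.1 z.2 `^ p)%:E < (e `^ p)%:E)%E ->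
  (cone_transport_dist rho p mu nu < e%:E)%E.
Proof.
move=> e0 hal cal; rewrite /cone_transport_dist; set E := ereal_inf _.
have E0 : (0 <= E)%E.
  apply: le_ereal_inf_tmp => _ [b _ <-]; apply: integral_ge0 => z _.
  by rewrite lee_fin powR_ge0.
have Ee : (E < (e `^ p)%:E)%E.
  by apply: le_lt_trans cal; apply: ereal_inf_lbound; exists alpha.
move: E0 Ee; case: (E) => [r| |]//; rewrite lee_fin lte_fin => r0 re.
rewrite poweR_EFin lte_fin.
have pV : 0 < p^-1 by rewrite invr_gt0.
have -> : e = (e `^ p) `^ p^-1 by rewrite -powRrM mulfV ?gt_eqF// powRr1// ltW.
by rewrite gt0_ltr_powR// nnegrE// powR_ge0.
Qed.

Lemma cone_transport_dist_lt_plan mu nu (e : R) : 0 < e ->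
  (cone_transport_dist rho p mu nu < e%:E)%E ->
  exists2 alpha, homogeneous_plans mu nu alpha &
    (\int[alpha]_z (rho z.1 z.2 `^ p)%:E < (e `^ p)%:E)%E.
Proof.
move=> e0; rewrite /cone_transport_dist; set E := ereal_inf _ => Ee.
have : (E < (e `^ p)%:E)%E.
  rewrite ltNge; apply/negP => eE; move: Ee; rewrite ltNge => /negP; apply.
  have -> : e = (e `^ p) `^ p^-1 by rewrite -powRrM mulfV ?gt_eqF// powRr1// ltW.
  rewrite -poweR_EFin gt0_ler_poweR ?invr_ge0 ?(ltW p_gt0)//.
  - by rewrite in_itv/= lee_fin powR_ge0 leey.
  - by rewrite in_itv/= leey andbT (le_trans _ eE)// lee_fin powR_ge0.
by move=> /ereal_inf_lt[_ [alpha ha <-] h]; exists alpha.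
Qed.

Section matched.
Variables (mu nu : {finite_measure set (borel X) -> \bar R}).
Hypotheses (rmu : radon mu) (rnu : radon nu).
Variables (I : Type) (s : seq I) (psi : I -> X -> R).
Hypothesis mpsi : forall i, measurable_fun setT (psi i : borel X -> R).
Hypothesis psi0 : forall i x, 0 <= psi i x.
Hypothesis psi_sum : forall x, \sum_(i <- s) psi i x <= 1.
Variables (a b : I -> R) (t H : R).
Hypothesis aE : forall i, (\int[mu]_x (psi i x)%:E = (a i)%:E)%E.
Hypothesis bE : forall i, (\int[nu]_x (psi i x)%:E = (b i)%:E)%E.
Hypothesis psi_near : forall i x y, psi i x != 0 -> psi i y != 0 ->
  d x y `^ p <= t.
Hypotheses (t0 : 0 <= t) (H0 : 0 <= H) (HP : forall x, vertex_cost p rho x <= H).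

(** [P] is the mass that can be matched, and is moved at a cost of at most [t]
    per unit; the two remainders go through the vertex. *)
Lemma matched_transport_dist_lt (e : R) : 0 < e ->
  let P := \sum_(i <- s) Num.min (a i) (b i) in
  t * P + H * (fine (mu setT) - P) + H * (fine (nu setT) - P) < e `^ p ->
  (cone_transport_dist rho p mu nu < e%:E)%E.
Proof.
move=> e0 P Pe.
have [pi [u [v [[meas_u u01] [meas_v v01] piE piP picost]]]] :=
  matched_product_coupling dm dt rmu rnu mpsi psi0 psi_sum aE bE.
have [alpha alphaP alphac] := partial_coupling_plan rho_metric rho_top hX
  rmu rnu meas_u u01 meas_v v01 (fun A mA => (piE A mA).1) (fun A mA => (piE A mA).2)
  H0 HP.
apply: (cone_transport_dist_lt e0 alphaP); apply: (le_lt_trans alphac).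
have muE : mu setT = (fine (mu setT))%:E by rewrite fineK// fin_num_measure.
have nuE : nu setT = (fine (nu setT))%:E by rewrite fineK// fin_num_measure.
have md : measurable_fun setT
    (fun z : borel (X * X)%type => base_dist rho z.1 z.2 `^ p).
  apply: (measurableT_comp (measurable_powR p)).
  exact: (continuous_measurable_real (metric_continuous2 dm dt)).
have c1 := picost _ t md (fun z => powR_ge0 _ _) t0 psi_near.
apply: (@le_lt_trans _ _ (t * P + H * (fine (mu setT) - P) +
    H * (fine (nu setT) - P))%:E).
  rewrite !EFinD; apply: leeD; first apply: leeD.
  - by apply: le_trans c1 _; rewrite piP EFinM.
  - by rewrite EFinM EFinB piP -muE.
  - by rewrite EFinM EFinB piP -nuE.
by rewrite lte_fin.
Qed.

End matched.

(** The tests are the total mass and a partition of unity subordinate to small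
    balls that cover all but a small part of [mu]. If [nu] nearly agrees with
    [mu] on them, then almost all of the mass can be matched inside the balls.
    The centres are taken in a dense set and the radius of the form 1/(k+1), so
    that only countably many systems of tests occur when [X] is separable. *)
Lemma finitely_many_tests (D : set X)
    (mu : {finite_measure set (borel X) -> \bar R}) (e : R) :
  (forall (r : R) x, 0 < r -> exists2 y, D y & d y x < r) ->
  radon mu -> 0 < e ->
  exists (s : seq X) (k : nat) (r : R), [/\ forall y, y \in s -> D y, 0 < r &
    forall nu : {finite_measure set (borel X) -> \bar R}, radon nu ->
      `|fine (nu setT) - fine (mu setT)| < r ->
      (forall y, y \in s ->
        `|fine (\int[nu]_x (partition_fun d s k.+1%:R^-1 y x)%:E) -
          fine (\int[mu]_x (partition_fun d s k.+1%:R^-1 y x)%:E)| < r) ->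
      (cone_transport_dist rho p nu mu < e%:E)%E /\
      (cone_transport_dist rho p mu nu < e%:E)%E].
Proof.
move=> Dd rmu e0.
have [H Hgt0 HP] := vertex_cost_ub hp rho_metric rho_top rho_hom.
have H0 := ltW Hgt0.
pose m := fine (mu setT); have m0 : 0 <= m by exact: fine_ge0.
(* a quarter of the admissible cost [T0] is spent on moving mass inside the
   balls, and three quarters on the mass that is not matched *)
pose T0 := e `^ p; have T00 : 0 < T0 by exact: powR_gt0.
pose t := T0 / (4 * (m + 1)).
have t0 : 0 < t by rewrite divr_gt0// mulr_gt0// ltr_wpDl.
have tm : t * m <= T0 / 4.
  rewrite /t mulrAC ler_pdivrMr ?mulr_gt0 ?ltr_wpDl//.
  rewrite (_ : T0 / 4 * _ = T0 * (m + 1)); last by field.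
  by rewrite ler_wpM2l ?(ltW T00)// lerDl.
pose tau := T0 / (4 * (H + 1)).
have tau0 : 0 < tau by rewrite divr_gt0// mulr_gt0// ltr_wpDl.
have tauH : H * (3 * tau) < T0 * (3 / 4).
  rewrite (_ : T0 * (3 / 4) = (H + 1) * (3 * tau)); last first.
    by rewrite /tau; field; rewrite gt_eqF// ltr_wpDl.
  by rewrite ltr_pM2r ?ltrDl ?ltr01// mulr_gt0.
have q0 : 0 < t `^ p^-1 / 4 by rewrite divr_gt0// powR_gt0.
have [k kq] := exists_natV_lt q0.
set r0 := k.+1%:R^-1 in kq.
have r00 : 0 < r0 by rewrite invr_gt0.
have [K [cK _]] := rmu setT measurableT tau tau0; rewrite setTD => Ktau.
have mK : measurable (~` K : set (borel X)).
  by apply: measurableC; apply: closed_borel; exact: compact_closed.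
have [s sD sK] := compact_net dm dt cK r00 (Dd r0 ^~ r00).
(* the unmatched mass will be at most [tau + size s * r] for [mu], and [r] more
   for [nu], whose total mass may differ; this makes [3 * tau] altogether *)
pose r := tau / (2 * (size s)%:R + 1).
have r_gt0 : 0 < r by rewrite divr_gt0// ltr_wpDl// mulr_ge0.
have rs : r * (2 * (size s)%:R + 1) = tau.
  by rewrite divfK// gt_eqF// ltr_wpDl// mulr_ge0.
exists s, k, r; split => // nu rnu nmr close; rewrite -/r0 in close.
pose psi := partition_fun d s r0.
have psi_ge0 y x : 0 <= psi y x by exact: partition_fun_ge0.
have mpsi y : measurable_fun setT (psi y : borel X -> R).
  by apply: continuous_measurable_real; exact: partition_fun_continuous.
have psi_sum x : \sum_(y <- s) psi y x <= 1 by exact: partition_fun_sum_le1.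
have psi_near y x x' : psi y x != 0 -> psi y x' != 0 -> d x x' `^ p <= t.
  move=> /partition_fun_neq0 yx /partition_fun_neq0 yx'.
  have h : d x x' <= t `^ p^-1.
    have := metric_triangle dm y x x'; rewrite (metric_sym dm x y).
    have : 4 * r0 < t `^ p^-1 by rewrite mulrC -ltr_pdivlMr.
    lra.
  have -> : t = (t `^ p^-1) `^ p.
    by rewrite -powRrM mulVf ?gt_eqF// powRr1// ltW.
  rewrite ge0_ler_powR ?nnegrE ?powR_ge0 ?(metric_ge0 dm)//.
  exact: ltW.
have int_fin (l : {finite_measure set (borel X) -> \bar R}) y :
    (\int[l]_x (psi y x)%:E \is a fin_num)%E.
  rewrite ge0_fin_numE; last by apply: integral_ge0 => x _; rewrite lee_fin.
  apply: (@le_lt_trans _ _ (\int[l]_(x in setT) cst 2%:E x)%E).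
    apply: ge0_le_integral => //.
    - by move=> x _; rewrite lee_fin.
    - exact/measurable_EFinP.
    - by move=> x _; rewrite lee_fin; exact: (partition_fun_le2 dm).
  rewrite integral_cst//; apply: lte_mul_pinfty => //.
  by rewrite ltey_eq fin_num_measure.
pose a y := fine (\int[mu]_x (psi y x)%:E)%E.
pose b y := fine (\int[nu]_x (psi y x)%:E)%E.
have aE y : (\int[mu]_x (psi y x)%:E = (a y)%:E)%E by rewrite fineK.
have bE y : (\int[nu]_x (psi y x)%:E = (b y)%:E)%E by rewrite fineK.
have sum_a_int : (\int[mu]_x (\sum_(y <- s) psi y x)%:E = (\sum_(y <- s) a y)%:E)%E.
  under eq_integral do rewrite -sumEFin.
  rewrite ge0_integral_sum//.
  - by rewrite -sumEFin; apply: eq_bigr => y _; exact: aE.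
  - by move=> y; exact/measurable_EFinP.
  - by move=> y x _; rewrite lee_fin.
have mE : mu setT = m%:E by rewrite fineK// fin_num_measure.
have msum : measurable_fun setT (fun x : borel X => \sum_(y <- s) psi y x).
  exact: measurable_sum.
have sum_a_le : \sum_(y <- s) a y <= m.
  rewrite -lee_fin -sum_a_int -mE.
  rewrite -[leRHS]mul1e -(integral_cst mu measurableT 1%E).
  apply: ge0_le_integral => //.
  - by move=> x _; rewrite lee_fin sumr_ge0.
  - exact/measurable_EFinP.
  - by move=> x _; rewrite lee_fin.
have sum_a_ge : m - \sum_(y <- s) a y <= tau.
  rewrite lerBlDr -lee_fin EFinD -sum_a_int -mE.
  apply: (@le_trans _ _ (mu (~` K) + \int[mu]_x (\sum_(y <- s) psi y x)%:E)%E);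
    last by rewrite leeD2r// ltW.
  rewrite -[in X in (_ <= X + _)%E](setIT (~` K)) -integral_indic//.
  rewrite -ge0_integralD//; last 3 first.
  - by apply/measurable_EFinP; exact: measurable_indic.
  - by move=> x _; rewrite lee_fin sumr_ge0.
  - exact/measurable_EFinP.
  rewrite -[leLHS]mul1e -(integral_cst mu measurableT 1%E).
  apply: ge0_le_integral => //.
  - by apply: emeasurable_funD; apply/measurable_EFinP => //; exact: measurable_indic.
  - move=> x _; rewrite /cst -EFinD lee_fin indicE.
    case: (boolP (x \in _)) => [_|]; first by rewrite lerDl sumr_ge0.
    rewrite notin_setE => /contrapT /sK xs.
    by rewrite add0r /psi partition_fun_sum_eq1.
pose P := \sum_(y <- s) Num.min (a y) (b y).
have P_le : P <= \sum_(y <- s) a y.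
  by apply: ler_sum => y _; rewrite ge_min lexx.
have P_ge : \sum_(y <- s) a y - (size s)%:R * r <= P.
  have -> : (size s)%:R * r = \sum_(y <- s) r.
    by rewrite big_const_seq count_predT iter_addr_0 mulr_natl.
  rewrite lerBlDr -big_split /=.
  rewrite big_seq [leRHS]big_seq; apply: ler_sum => y ys.
  have := close y ys; rewrite -/(b y) -/(a y) ltr_norml => /andP[h1 h2].
  have [ab|ba] := leP (a y) (b y); first by rewrite lerDl ltW.
  lra.
pose n := fine (nu setT).
have nm : n - m < r by move: nmr; rewrite ltr_norml => /andP[].
have mP : m - P <= tau + (size s)%:R * r by lra.
have nP : n - P <= tau + (size s)%:R * r + r by lra.
have tP : t * P <= T0 / 4.
  by apply: le_trans tm; rewrite ler_wpM2l ?(ltW t0)//; lra.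
have PT : t * P + H * (m - P) + H * (n - P) < T0.
  have h : (m - P) + (n - P) <= 3 * tau.
    have -> : 3 * tau = 2 * tau + r * (2 * (size s)%:R + 1) by rewrite rs; ring.
    lra.
  have := ler_wpM2l H0 h; rewrite mulrDr; lra.
split.
  apply: (matched_transport_dist_lt rnu rmu mpsi psi_ge0 psi_sum bE aE psi_near
    (ltW t0) H0 HP e0).
  under eq_bigr do rewrite minC.
  by rewrite -/P -addrA [X in _ + X]addrC addrA.
exact: (matched_transport_dist_lt rmu rnu mpsi psi_ge0 psi_sum aE bE psi_near
    (ltW t0) H0 HP e0).
Qed.

End transport_bounds.

(** * The characterization of convergence, and separability *)

Lemma near_seq (T : eqType) (s : seq T) (P : T -> nat -> Prop) :
  (forall y, y \in s -> \forall n \near \oo, P y n) ->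
  \forall n \near \oo, forall y, y \in s -> P y n.
Proof.
elim: s => [|x s IH] h; first by apply: nearW.
have h1 : \forall n \near \oo, P x n by apply: h; rewrite mem_head.
have h2 : \forall n \near \oo, forall y, y \in s -> P y n.
  by apply: IH => y ys; apply: h; rewrite in_cons ys orbT.
apply: filterS2 h1 h2 => n Px Ps y; rewrite in_cons => /predU1P[->//|].
exact: Ps.
Qed.

Lemma bounded_funP (R : realType) (T : Type) (f : T -> R) :
  bounded_fun f <-> exists M : R, forall x, `|f x| <= M.
Proof.
split=> [[M [_ MP]]|[M fM]].
  exists (M + 1) => x; apply: (MP (M + 1)) => //.
  by rewrite ltrDl.
exists M; split; first by rewrite num_real.
by move=> N MN x _ /=; rewrite (le_trans (fM x))// ltW.
Qed.

Lemma bounded_continuous_integrable (R : realType) (T : ptopologicalType)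
    (mu : {finite_measure set (borel T) -> \bar R}) (f : T -> R) :
  continuous f -> bounded_fun f -> (\int[mu]_x (f x)%:E)%E \is a fin_num.
Proof.
move=> fc fb; apply: integrable_fin_num => //.
apply: measurable_bounded_integrable => //.
- by rewrite ltey_eq fin_num_measure.
- exact: continuous_measurable_real.
Qed.

Lemma weak_cvg_fine (R : realType) (T : ptopologicalType)
    (mu_ : nat -> {finite_measure set (borel T) -> \bar R})
    (mu : {finite_measure set (borel T) -> \bar R}) (f : T -> R) (e : R) :
  weak_cvg mu_ mu -> continuous f -> bounded_fun f -> 0 < e ->
  \forall n \near \oo, `|fine (\int[mu_ n]_x (f x)%:E)%E -
    fine (\int[mu]_x (f x)%:E)%E| < e.
Proof.
move=> wc fc fb e0.
have := wc f fc fb.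
rewrite -[X in _ --> X](fineK (bounded_continuous_integrable mu fc fb)).
move=> /fine_cvg /cvgrPdist_lt/(_ _ e0).
by apply: filterS => n; rewrite distrC.
Qed.

Lemma powR_continuous_pos (R : realType) (p a : R) : 0 < a ->
  {for a, continuous (fun x : R => x `^ p)}.
Proof.
move=> a0; apply: (@differentiable_continuous R R R).
by apply/derivable1_diffP; apply: derivable_powR; rewrite in_itv/= a0.
Qed.

Lemma countable_surj (T : pointedType) (A : set T) : countable A ->
  exists y : nat -> T, forall x, A x -> exists n, y n = x.
Proof.
move=> /countable_injP[f finj].
have /choice[y yP] : forall n, exists x, (exists2 z, A z & f z = n) ->
    A x /\ f x = n.
  move=> n; have [[z Az fz]|h] := pselect (exists2 z, A z & f z = n).
    by exists z.
  by exists point.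
exists y => x Ax; exists (f x).
have [Ay fy] : A (y (f x)) /\ f (y (f x)) = f x by apply: yP; exists x.
by apply: finj => //; rewrite inE.
Qed.

Section characterization.
Context (R : realType) (X : ptopologicalType) (hX : hausdorff_space X).
Context (p : R) (hp : 1 <= p).
Local Notation C := (cone R X).
Variable rho : C -> C -> R.
Hypotheses (rho_metric : is_metric rho) (rho_top : induces_topology rho).
Hypothesis rho_hom : radially_homogeneous (fun c d => rho c d `^ p).

Local Notation M := (finite_moment_measures rho p).
Local Notation D := (cone_transport_dist rho p).
Let d := base_dist rho.
Let dm : is_metric d := base_dist_metric rho_metric.
Let dt : induces_topology d := base_dist_topology rho_top.

Lemma vertex_cost_continuous : continuous (vertex_cost p rho).
Proof.
move=> x.
have c0 : 0 < rho (cone_unit R x) (vertex R X).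
  have [c cp lb] := vertex_cost_lb hp rho_metric rho_top.
  rewrite lt_def (metric_ge0 rho_metric) andbT; apply/eqP => h.
  move: (lt_le_trans cp (lb x)); rewrite /vertex_cost h powR0 ?ltxx//.
  by rewrite gt_eqF// (lt_le_trans ltr01).
apply: (@continuous_comp _ _ _ (fun x => rho (cone_unit R x) (vertex R X))
  (fun r : R => r `^ p)); last exact: powR_continuous_pos.
rewrite (_ : (fun x => _) = (fun x => rho (vertex R X) (cone_unit R x))); last first.
  by apply/funext => y; rewrite (metric_sym rho_metric).
apply: (@continuous_comp _ _ _ (@cone_unit R X) (rho (vertex R X))).
  exact: cone_unit_continuous.
exact: (metric_continuousr rho_metric rho_top).
Qed.

Lemma vertex_cost_bounded : bounded_fun (vertex_cost p rho).
Proof.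
have [H H0 HP] := vertex_cost_ub hp rho_metric rho_top rho_hom.
apply/bounded_funP; exists H => x.
by rewrite ger0_norm ?HP// powR_ge0.
Qed.

Lemma transport_cvg_weak mu_ mu :
  D (mu_ n) mu @[n --> \oo] --> 0%E -> weak_cvg mu_ mu.
Proof.
move=> Dc phi phic phib.
have muf := bounded_continuous_integrable mu phic phib.
rewrite -(fineK muf); apply/fine_cvgP; split.
  by apply: nearW => n; exact: bounded_continuous_integrable.
apply/cvgrPdist_le => t t0.
have [B phiB] := (bounded_funP phi).1 phib.
have t20 : 0 < t / 2 by rewrite divr_gt0.
have [L L0 LP] := homogeneous_plans_integral_close hp rho_metric rho_top rho_hom
  phic phiB mu t20.
pose q := t / 2 / (L + 1).
have q0 : 0 < q by rewrite divr_gt0// ltr_wpDl.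
pose e := q `^ p^-1; have e0 : 0 < e by exact: powR_gt0.
have p_gt0 : 0 < p by exact: lt_le_trans ltr01 hp.
have eq : e `^ p = q by rewrite -powRrM mulVf ?gt_eqF// powRr1// ltW.
have small : \forall n \near \oo, (D (mu_ n) mu < e%:E)%E.
  rewrite -[X in _ --> X]/(0%:E) in Dc.
  move/fine_cvgP : Dc => [fin /cvgr_lt/(_ _ e0)]; apply: filterS2 fin => n fin h.
  by rewrite -(fineK fin) lte_fin.
apply: filterS small => n /(cone_transport_dist_lt_plan hp e0)[alpha ha].
rewrite eq => cost; have := LP _ _ ha.
have munf := bounded_continuous_integrable (mu_ n) phic phib.
rewrite -(fineK munf) -(fineK muf) -EFinB /= distrC => h.
rewrite -lee_fin; apply: (le_trans h).
apply: (@le_trans _ _ ((t / 2)%:E + L%:E * q%:E)%E).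
  by rewrite leeD2l// lee_wpmul2l ?lee_fin// ltW.
rewrite -EFinM -EFinD lee_fin.
have : L * q <= t / 2.
  rewrite /q mulrA ler_pdivrMr ?ltr_wpDl//.
  by rewrite mulrC ler_wpM2l ?(ltW t20)// lerDl.
lra.
Qed.

Lemma weak_transport_cvg mu_ mu : (forall n, radon (mu_ n)) -> radon mu ->
  weak_cvg mu_ mu -> D (mu_ n) mu @[n --> \oo] --> 0%E.
Proof.
move=> rmu_ rmu wc.
have small (e : R) : 0 < e -> \forall n \near \oo, (D (mu_ n) mu < e%:E)%E.
  move=> e0.
  have Dd (r : R) x : 0 < r -> exists2 y, [set: X] y & d y x < r.
    by move=> r0; exists x => //; rewrite (metric_xx dm).
  have [s [k [r [_ r0 H]]]] :=
    finitely_many_tests hX hp rho_metric rho_top rho_hom Dd rmu e0.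
  have k0 : 0 < k.+1%:R^-1 :> R by rewrite invr_gt0.
  have c1 : continuous (cst 1 : X -> R) by move=> x; exact: cvg_cst.
  have b1 : bounded_fun (cst 1 : X -> R).
    by apply/bounded_funP; exists 1 => x; rewrite normr1.
  have h1 := weak_cvg_fine wc c1 b1 r0.
  have h2 : \forall n \near \oo, forall y, y \in s ->
      `|fine (\int[mu_ n]_x (partition_fun d s k.+1%:R^-1 y x)%:E)%E -
        fine (\int[mu]_x (partition_fun d s k.+1%:R^-1 y x)%:E)%E| < r.
    apply: near_seq => y _; apply: (weak_cvg_fine wc) => //.
      exact: partition_fun_continuous.
    apply/bounded_funP; exists 2 => x.
    by rewrite ger0_norm ?partition_fun_ge0//; exact: (partition_fun_le2 dm).
  have mass (m : {finite_measure set (borel X) -> \bar R}) :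
      (\int[m]_x 1%:E = m setT)%E.
    by rewrite -[LHS]/(\int[m]_(x in setT) cst 1%E x)%E integral_cst// mul1e.
  apply: filterS2 h1 h2 => n h1 h2; apply: (H (mu_ n) (rmu_ n) _ h2).1.
  by move: h1; rewrite !mass.
rewrite -[X in _ --> X]/(0%:E); apply/fine_cvgP; split.
  apply: filterS (small 1 ltr01) => n h.
  by rewrite ge0_fin_numE ?cone_transport_dist_ge0// (lt_trans h) ?ltry.
apply/cvgrPdist_lt => e e0; apply: filterS (small e e0) => n h.
have D0 := cone_transport_dist_ge0 p rho (mu_ n) mu.
rewrite sub0r normrN /= ger0_norm ?fine_ge0// -lte_fin fineK//.
by rewrite ge0_fin_numE// (lt_trans h) ?ltry.
Qed.

(** A code consists of a finite system of tests, of rational values for them and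
    of a precision; there are countably many codes. One measure is chosen for
    each code that some measure realizes, and two measures that realize the same
    code are close to each other. *)
Lemma transport_separable : separable_space X -> separable_for M D.
Proof.
move=> [S0 S0c S0d]; have [y yP] := countable_surj S0c.
have Dd (r : R) x : 0 < r -> exists2 z, range y z & d z x < r.
  move=> r0; have [|z [/= xz Sz]] := S0d _ _ (open_metric dm dt x r).
    by exists x; rewrite /= (metric_xx dm).
  have [n yn] := yP _ Sz; exists z; first by exists n.
  by rewrite (metric_sym dm).
pose code := ((seq nat * nat) * (rat * seq rat * nat))%type.
pose realizes (c : code) (nu : {finite_measure set (borel X) -> \bar R}) :=
  let: ((js, k), (q, qs, l)) := c in
  [/\ M nu, `|fine (nu setT) - ratr q| < l.+1%:R^-1 &
    forall i, (i < size js)%N ->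
      `|fine (\int[nu]_x (partition_fun d (map y js) k.+1%:R^-1
           (y (nth 0%N js i)) x)%:E)%E - ratr (nth 0 qs i)| < l.+1%:R^-1].
have [nu0 _] := finite_measure_of (m := mzero)
  (ltry 0 : (mzero [set: borel X] < +oo :> \bar R)%E).
have /choice[F FP] : forall c, exists nu,
    (exists nu', realizes c nu') -> realizes c nu.
  move=> c; have [[nu h]|h] := pselect (exists nu', realizes c nu').
    by exists nu.
  by exists nu0.
exists (F @` [set c | exists nu, realizes c nu]); split.
- apply: (sub_countable (card_image_le _ _)); exact: countableP.
- move=> _ [c ex_c <-]; have := FP _ ex_c.
  by case: c {ex_c} => [[js k] [[q qs] l]] [].
move=> mu Mmu e e0.
have [s [k [r [sy r0 H]]]] :=
  finitely_many_tests hX hp rho_metric rho_top rho_hom Dd Mmu.1 e0.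
have [js sE] : exists js : seq nat, s = map y js.
  elim: s sy {H} => [|z s IH] sy; first by exists [::].
  have [n _ yn] := sy z (mem_head _ _).
  have [|js ->] := IH; first by move=> w ws; apply: sy; rewrite in_cons ws orbT.
  by exists (n :: js); rewrite /= yn.
have r20 : 0 < r / 2 by rewrite divr_gt0.
have [l lr] := exists_natV_lt r20.
have approx (a : R) : exists q : rat, `|a - ratr q| < l.+1%:R^-1.
  have l0 : 0 < l.+1%:R^-1 :> R by rewrite invr_gt0.
  have [|q] := @rat_in_itvoo R (a - l.+1%:R^-1) (a + l.+1%:R^-1).
    by apply: (@lt_trans _ _ a); rewrite ?ltrDl ?gtrBl.
  rewrite in_itv/= => /andP[h1 h2]; exists q.
  by rewrite ltr_distlC h1 h2.
have [q qP] := approx (fine (mu setT)).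
have /choice[f fP] := approx.
pose val z (m : {finite_measure set (borel X) -> \bar R}) :=
  fine (\int[m]_x (partition_fun d s k.+1%:R^-1 z x)%:E)%E.
pose qs := [seq f (val (y j) mu) | j <- js].
pose c : code := ((js, k), (q, qs, l)).
have cmu : realizes c mu.
  split => // i ijs; rewrite -sE (nth_map 0%N)//; exact: fP.
have [MF massF valF] := FP c (ex_intro _ _ cmu).
exists (F c); first by exists c => //; exists mu.
have two (a b g : R) : `|a - g| < l.+1%:R^-1 -> `|b - g| < l.+1%:R^-1 ->
    `|a - b| < r.
  move=> h1 h2; rewrite (_ : a - b = (a - g) - (b - g)); last by ring.
  apply: le_lt_trans (ler_normB _ _) _; rewrite [r]splitr.
  by apply: ltrD; [exact: lt_trans lr|exact: lt_trans lr].
apply: (H (F c) MF.1 _ _).2; first exact: two massF qP.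
move=> z; rewrite {1}sE => /mapP[j jjs ->].
have ij : (index j js < size js)%N by rewrite index_mem.
have := valF _ ij; rewrite -sE (nth_map 0%N)// nth_index// => h.
apply: two h _; exact: fP.
Qed.

End characterization.

Unset Implicit Arguments.

Theorem theorem5 (R : realType) (X : ptopologicalType)
    (hX : hausdorff_space X) (crX : completely_regular_space X)
    (p : R) (hp : 1 <= p)
    (rho : cone R X -> cone R X -> R)
    (rho_metric : is_metric rho) (rho_top : induces_topology rho)
    (rho_hom : radially_homogeneous (fun c d => rho c d `^ p)) :
  (forall (mu_ : nat -> {finite_measure set (borel X) -> \bar R})
          (mu : {finite_measure set (borel X) -> \bar R}),
     (forall n, finite_moment_measures rho p (mu_ n)) ->
     finite_moment_measures rho p mu ->
     (cone_transport_dist rho p (mu_ n) mu @[n --> \oo] --> 0%E <->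
      (weak_cvg mu_ mu /\
       vertex_moment rho p (mu_ n) @[n --> \oo] --> vertex_moment rho p mu)))
  /\
  (separable_space X ->
   separable_for (finite_moment_measures rho p) (cone_transport_dist rho p)).
Proof.
split; last exact: transport_separable.
move=> mu_ mu Mmu_ Mmu; split=> [Dc|[wc _]]; last first.
  apply: weak_transport_cvg => //; last by case: Mmu.
  by move=> n; case: (Mmu_ n).
have wc := transport_cvg_weak hp rho_metric rho_top rho_hom Dc.
split => //; apply: wc.
- exact: vertex_cost_continuous.
- exact: vertex_cost_bounded.
Qed.
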